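(* Suppose $G$ is a compactly generated totally disconnected locally compact group. Then (a) $G$ is geometrically amenable if and only if it admits a $1$-Lipschitz proper action on a locally finite amenable graph; and (b) $\mathrm{F\o l}^\ast G=0$ if and only if $G$ admits a contingently $1$-Lipschitz proper action on a locally finite amenable graph.
   Context: Groups. Let $\mu$ be a (left) Haar measure on the locally compact group $G$. $G$ is geometrically amenable if for every compact $K\subseteq G$ and every $\varepsilon>0$ there is a compact set $U\subseteq G$ of positive measure with $\mu(UK)/\mu(U)\le 1+\varepsilon$. For $G$ compactly generated, $\mathrm{F\o l}^\ast G=\inf_S\inf_U\mu(US\setminus U)/\mu(U)$, where the infima are over all compact symmetric generating sets $S$ for $G$ and all compact subsets $U\subseteq G$ of positive measure. Graphs. Graphs are not assumed connected. For a set $A$ of vertices of a graph $\Gamma$, $\partial A$ is the set of vertices not in $A$ that have a neighbour in $A$. The Cheeger constant is $\mathrm{h}(\Gamma)=\inf |\partial A|/|A|$ over finite non-empty sets $A$ of vertices, and $\Gamma$ is amenable if $\mathrm{h}(\Gamma)=0$. Actions. All actions of topological groups on graphs are by graph automorphisms and continuous, i.e. the induced homomorphism $G\to\mathrm{Aut}(\Gamma)$ is continuous for the topology of pointwise convergence on $\mathrm{Aut}(\Gamma)$. An action is proper if vertex stabilisers are compact in $G$. Let $G$ be a compactly generated locally compact group acting properly on a locally finite graph $\Gamma$ and let $C>0$. For a compact symmetric generating set $S$ of $G$, $(G,S)$ denotes $G$ with the word metric of $S$, and orbits $G\cdot x$ carry the graph distance of $\Gamma$. The action is $C$-Lipschitz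 if there is a compact symmetric generating set $S$ such that in each orbit there is some vertex $x$ for which the orbit map $(G,S)\to G\cdot x$, $g\mapsto g\cdot x$, is $C$-Lipschitz. The action is contingently $C$-Lipschitz if for every vertex $x\in\Gamma$ there is a compact symmetric generating set $S_x\subseteq G$ such that the orbit map $(G,S_x)\to G\cdot x$, $g\mapsto g\cdot x$, is $C$-Lipschitz. *)

(* Defs.v *)
From HB Require Import structures.
From mathcomp Require Import all_boot all_order all_algebra.
From mathcomp Require Import all_classical all_reals all_analysis.

Set Implicit Arguments.
Unset Strict Implicit.
Unset Printing Implicit Defensive.

Import Order.TTheory GRing.Theory Num.Theory.

Local Open Scope classical_set_scope.
Local Open Scope ring_scope.

(* The library only has additive (hence commutative) topological groups. *)
HB.mixin Record isTopologicalGroup G & Topological G & Group G := {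
  mulg_continuous : continuous (fun p : G * G => (p.1 * p.2)%g : G) ;
  invg_continuous : continuous (fun x : G => (x^-1)%g : G)
}.

#[short(type="topologicalGroupType")]
HB.structure Definition TopologicalGroup :=
  {G of Topological G & Group G & isTopologicalGroup G}.

(* Measurable types must be pointed: [pointed_group G] is G pointed at 1. *)
Definition pointed_group (G : topologicalGroupType) : Type := G.
HB.instance Definition _ (G : topologicalGroupType) :=
  Choice.copy (pointed_group G) G.
HB.instance Definition _ (G : topologicalGroupType) :=
  isPointed.Build (pointed_group G) (1%g : G).

(* G with its Borel sigma-algebra. *)
Notation borel G := (@g_sigma_algebraType (pointed_group G) (@open G)).

Section Groups.
Variables (R : realType) (G : topologicalGroupType).
Implicit Types (S K U : set G) (mu : {measure set (borel G) -> \bar R}).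

Definition mulset U S : set G := [set (u * s)%g | u in U & s in S].

(* Hausdorffness is part of the usual definition of a locally compact group. *)
Definition locally_compact_group : Prop :=
  hausdorff_space G /\ locally_compact [set: G].

Definition is_subgroup (H : set G) : Prop :=
  H 1%g /\ forall x y : G, H x -> H y -> H (x * y^-1)%g.

Definition generates S : Prop :=
  forall H : set G, is_subgroup H -> S `<=` H -> H = [set: G].

Definition compactly_generated : Prop := exists S, compact S /\ generates S.

Definition compact_symmetric_generating S : Prop :=
  [/\ compact S, (forall x : G, S x -> S (x^-1)%g) & generates S].

(* Nonzero left-invariant Radon measure on the Borel sets of G. *)
Definition left_haar_measure mu : Prop :=
  [/\ (forall (g : G) (A : set (borel G)), measurable A ->
         mu [set (g * x)%g | x in (A : set G)] = mu A),
      (forall K, compact K -> (mu K < +oo)%E),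
      (forall A : set (borel G), measurable A ->
         mu A = ereal_inf [set mu V | V in [set V : set G | open V /\ A `<=` V]]),
      (forall V : set G, open V ->
         mu V = ereal_sup [set mu K | K in [set K : set G | compact K /\ K `<=` V]])
    & mu [set: G] != 0%E].

Definition geometrically_amenable mu : Prop :=
  forall K, compact K -> forall eps : R, 0 < eps ->
  exists U, [/\ compact U, (0 < mu U)%E
              & (mu (mulset U K) / mu U <= (1 + eps)%:E)%E].

Definition folner_star mu : \bar R :=
  ereal_inf [set ereal_inf [set (mu (mulset U S `\` U) / mu U)%E
                           | U in [set U : set G | compact U /\ (0 < mu U)%E]]
            | S in [set S : set G | compact_symmetric_generating S]].

(* The word metric is the left-invariant one, d_S(g, h) = |g^-1 h|_S, S being
   symmetric: with it, the orbit map of x under a left action is C-Lipschitz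
   iff every s in S moves x by a distance at most C. *)
Definition word_length S (g : G) : \bar R :=
  ereal_inf [set (size s)%:R%:E
            | s in [set s : seq G | (forall x, x \in s -> S x) /\
                                    (\big[*%g/1%g]_(x <- s) x = g)%g]].

Definition word_dist S (g h : G) : \bar R := word_length S (g^-1 * h)%g.

End Groups.

Record simple_graph := SimpleGraph {
  vertex :> choiceType ;
  adj : rel vertex ;
  adj_sym : symmetric adj ;
  adj_irrefl : irreflexive adj
}.
Arguments adj {s}.

Section Graphs.
Variables (R : realType) (Gamma : simple_graph).

Definition locally_finite : Prop :=
  forall x : Gamma, finite_set [set y | adj x y].

Definition boundary (A : set Gamma) : set Gamma :=
  [set y | ~ A y /\ exists2 x, A x & adj x y].

Definition cheeger : \bar R :=
  ereal_inf [set (counting (boundary A) / counting A)%E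
            | A in [set A : set Gamma | finite_set A /\ A !=set0]].

Definition amenable_graph : Prop := cheeger = 0%E.

(* +oo between distinct connected components. *)
Definition graph_dist (x y : Gamma) : \bar R :=
  ereal_inf [set (size p)%:R%:E
            | p in [set p : seq Gamma | path adj x p /\ last x p = y]].

End Graphs.

Section Actions.
Variables (R : realType) (G : topologicalGroupType) (Gamma : simple_graph).
Implicit Types act : G -> Gamma -> Gamma.

(* Aut(Gamma) carries the subspace topology of the space of maps
   Gamma -> Gamma with pointwise convergence, Gamma being discrete, so
   continuity into Aut(Gamma) is continuity into that space. *)
Definition graph_action act : Prop :=
  [/\ (forall x, act 1%g x = x),
      (forall g h x, act (g * h)%g x = act g (act h x)),
      (forall g x y, adj (act g x) (act g y) = adj x y)
    & continuous (act : G -> {ptws Gamma -> discrete_topology Gamma})].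

Definition stabiliser act (x : Gamma) : set G := [set g | act g x = x].

Definition proper_action act : Prop :=
  graph_action act /\ forall x, compact (stabiliser act x).

Definition orbit act (x : Gamma) : set Gamma := range (fun g => act g x).

Definition orbit_map_lipschitz (C : R) act (S : set G) (x : Gamma) : Prop :=
  forall g h : G,
    (graph_dist R (act g x) (act h x) <= C%:E * word_dist R S g h)%E.

Definition lipschitz_action (C : R) act : Prop :=
  exists2 S : set G, compact_symmetric_generating S &
    forall y : Gamma, exists2 x, orbit act y x & orbit_map_lipschitz C act S x.

Definition contingently_lipschitz_action (C : R) act : Prop :=
  forall x : Gamma, exists2 S : set G,
    compact_symmetric_generating S & orbit_map_lipschitz C act S x.

End Actions.

(* Main.v *)
From HB Require Import structures.
From mathcomp Require Import all_boot all_order all_algebra finmap lra ring zify.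
From mathcomp Require Import all_classical all_reals all_analysis.
From mathcomp Require Import measurable_realfun.
Require Import Defs.

(** Both equivalences rest on one dictionary. Let [L] be a compact open subgroup and let
    [phi] be a map on [G] whose non-empty fibres are the left cosets of [L]: an orbit map
    [g |-> g x] with [L] the stabiliser of [x], or [g |-> g L]. A finite set [B] of values
    of [phi] then has a compact open preimage of volume [#B * vol L]
    ([vol_coset_map_preimage]), so ratios of cardinals of sets of vertices are ratios of
    Haar measures.

    From graphs to groups. Let [A] be a finite set of vertices with [#(boundary A)] at most
    [d * #A]. By pigeonhole some orbit meets [A] and satisfies the same inequality
    ([exists_fiber_card_le]). If [S] moves the vertex [x] of that orbit by at most one, and
    [U] is the set of the [g] with [g x] in [A], then [U S \ U] lies over the boundary of
    [A], so its measure is at most [d * mu U] ([amenable_action_folner]). This gives the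
    converse half of (b) at once, because there [S] may depend on the orbit.

    From groups to graphs. Take the disjoint union over [n] of the graphs on [G / K_n] in
    which [g K_n] and [g k s K_n] are neighbours for [k] in [K_n] and [s] in [S_n]. The
    element [g s g^-1] moves [g K_n] to a neighbour, so the action is contingently
    1-Lipschitz, and it is 1-Lipschitz when [S_n] is constant. It is amenable as soon as the
    sets [U K_n S_n K_n \ U K_n] can be made relatively small ([coset_graph_amenable]).
    For (a) constant sequences do. For (b) outer regularity shrinks [K_n] until the
    thickening costs little ([folner_thickening]), and [K_n] and [S_n] then vary with [n].

    The converse half of (a) needs more. There the generating set [S] is fixed, but the
    stabilisers may shrink as [d] tends to 0, and [S] may have empty interior, so
    [mu (U S \ U) <= d * mu U] does not bound [mu (U Q \ U)] for a compact set [Q]. First,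
    these inequalities force right translations to preserve volume, hence
    [mu (U w \ U) <= n * d * mu U] for each word [w] of length [n] in [S]; and a compact set
    consists of words of bounded length ([compact_sub_word_ball], a Steinhaus argument).
    So [U] is almost invariant under every single element of a given compact set. Next, for
    a fixed compact open subgroup [K], the function counting the cosets of a small subgroup
    that lie in [x K] and in [U] is right [K]-invariant, and summing over its level sets
    (a discrete coarea formula) produces a right [K]-invariant level set [V] which is
    almost invariant under finitely many prescribed elements ([folner_level_set]). Since
    [V Q] is a finite union of right translates of [V], this controls [mu (V Q)]. *)

Set Implicit Arguments.
Unset Strict Implicit.
Unset Printing Implicit Defensive.
Import Order.TTheory GRing.Theory Num.Theory.
Local Open Scope classical_set_scope.
Local Open Scope ring_scope.

(** * Translates and products in a topological group *)

Section TopologicalGroups.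
Variable G : topologicalGroupType.
Implicit Types (A B C K L S T U V : set G) (g h x y : G).
Local Open Scope group_scope.

Lemma mulg_cvg (I : Type) (F : set_system I) (a b : I -> G) x y :
  Filter F -> a @ F --> x -> b @ F --> y -> (fun i => a i * b i) @ F --> x * y.
Proof.
move=> FF ax bY.
exact: (@cvg_comp _ _ _ (fun i => (a i, b i)) (fun p : G * G => (p.1 * p.2 : G)) _ _ _
  (cvg_pair ax bY) (@mulg_continuous G (x, y))).
Qed.

Lemma mulgl_continuous g : continuous (fun x : G => g * x).
Proof. by move=> x; apply: mulg_cvg; [exact: cvg_cst|exact: cvg_id]. Qed.

Lemma mulgr_continuous g : continuous (fun x : G => x * g).
Proof. by move=> x; apply: mulg_cvg; [exact: cvg_id|exact: cvg_cst]. Qed.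

Definition ltranslate g A : set G := [set g * x | x in A].
Definition rtranslate A g : set G := [set x * g | x in A].

Lemma ltranslateE g A : ltranslate g A = (fun x => g^-1 * x) @^-1` A.
Proof.
apply/seteqP; split=> [_ [x Ax <-]|x Ax] /=; first by rewrite mulKg.
by exists (g^-1 * x) => //; rewrite mulVKg.
Qed.

Lemma rtranslateE g A : rtranslate A g = (fun x => x * g^-1) @^-1` A.
Proof.
apply/seteqP; split=> [_ [x Ax <-]|x Ax] /=; first by rewrite mulgK.
by exists (x * g^-1) => //; rewrite mulgVK.
Qed.

Lemma open_ltranslate g A : open A -> open (ltranslate g A).
Proof. by rewrite ltranslateE => oA; apply: open_comp => // x _; exact: mulgl_continuous. Qed.

Lemma open_rtranslate g A : open A -> open (rtranslate A g).
Proof. by rewrite rtranslateE => oA; apply: open_comp => // x _; exact: mulgr_continuous. Qed.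

Lemma compact_ltranslate g A : compact A -> compact (ltranslate g A).
Proof.
by apply: continuous_compact; apply: continuous_subspaceT; exact: mulgl_continuous.
Qed.

Lemma compact_rtranslate g A : compact A -> compact (rtranslate A g).
Proof.
by apply: continuous_compact; apply: continuous_subspaceT; exact: mulgr_continuous.
Qed.

Lemma compact_mulset A B : compact A -> compact B -> compact (mulset A B).
Proof.
move=> cA cB.
have -> : mulset A B = (fun p : G * G => (p.1 * p.2 : G)) @` (A `*` B).
  apply/seteqP; split=> [_ [a Aa [b Bb <-]]|_ [[a b] [/= Aa Bb] <-]].
    by exists (a, b).
  by exists a => //; exists b.
apply: continuous_compact; last exact: compact_setX.
by apply: continuous_subspaceT; exact: mulg_continuous.
Qed.

Lemma compact_invset A : compact A -> compact [set x^-1 | x in A].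
Proof.
by apply: continuous_compact; apply: continuous_subspaceT; exact: invg_continuous.
Qed.

Lemma open_mulset A B : open B -> open (mulset A B).
Proof.
move=> oB; have -> : mulset A B = \bigcup_(a in A) ltranslate a B.
  by apply/seteqP; split=> [_ [a Aa [b Bb <-]]|_ [a Aa [b Bb <-]]];
    exists a => //; exists b.
by apply: bigcup_open => a _; exact: open_ltranslate.
Qed.

Lemma mulsetA A B C : mulset (mulset A B) C = mulset A (mulset B C).
Proof.
apply/seteqP; split=> [_ [_ [a Aa [b Bb <-]] [c Cc <-]]|].
  by exists a => //; exists (b * c); [exists b => //; exists c|rewrite mulgA].
move=> _ [a Aa [_ [b Bb [c Cc <-]] <-]].
by exists (a * b); [exists a => //; exists b|exists c => //; rewrite mulgA].
Qed.

Lemma mulset_sub A B A' B' : A `<=` A' -> B `<=` B' ->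
  mulset A B `<=` mulset A' B'.
Proof.
by move=> sA sB _ [a Aa [b Bb <-]]; exists a; [exact: sA|exists b => //; exact: sB].
Qed.

Section Subgroup.
Variables (H : set G) (sH : is_subgroup H).

Lemma subgroup1 : H 1. Proof. by case: sH. Qed.
Lemma subgroupV x : H x -> H x^-1.
Proof. by case: sH => H1 HV Hx; have := HV _ _ H1 Hx; rewrite mul1g. Qed.
Lemma subgroupM x y : H x -> H y -> H (x * y).
Proof. by move=> Hx /subgroupV Hy; case: sH => _ /(_ _ _ Hx Hy); rewrite invgK. Qed.
Lemma subgroupMr x y : H x -> H (y * x) <-> H y.
Proof.
move=> Hx; split=> [Hxy|Hy]; last exact: subgroupM.
by have := subgroupM Hxy (subgroupV Hx); rewrite mulgK.
Qed.

Lemma subgroup_ltranslate_eq g h : ltranslate g H = ltranslate h H <-> H (g^-1 * h).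
Proof.
split=> [E|Hgh].
  have : ltranslate g H h by rewrite E; exists 1; rewrite ?mulg1//; exact: subgroup1.
  by rewrite ltranslateE.
apply/seteqP; split=> x; rewrite !ltranslateE /=; last first.
  by move=> /(subgroupM Hgh); rewrite -mulgA mulVKg.
have /(_ Hgh) := @subgroupV (g^-1 * h).
by rewrite invgM invgK => /subgroupM /[apply]; rewrite -mulgA mulVKg.
Qed.

End Subgroup.

Lemma subgroupI A B : is_subgroup A -> is_subgroup B -> is_subgroup (A `&` B).
Proof.
move=> sA sB; split; first by split; exact: subgroup1.
by move=> x y [Ax Bx] [Ay By]; split; [case: sA => _; exact|case: sB => _; exact].
Qed.

Lemma nearM1 (x : G) (P : set G) : nbhs x P -> \forall y \near (1:G), P (x * y).
Proof.
move=> nP; have : (fun y : G => x * y) @ (1 : G) --> x * 1.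
  exact: mulgl_continuous.
by rewrite mulg1 => /(_ _ nP).
Qed.

(** The tube lemma, used once for each compact factor: a neighbourhood of 1 can be
    inserted in the middle of a product of compact sets without leaving an open set. *)
Lemma near_mulset A B V : compact A -> compact B -> open V ->
  mulset A B `<=` V ->
  \forall w \near (1 : G), forall a b, A a -> B b -> V (a * w * b).
Proof.
move=> /compact_near_coveringP cA /compact_near_coveringP cB oV AB.
suff H : \forall w \near (1 : G), A `<=` (fun a => B `<=` (fun b => V (a * w * b))).
  by apply: filterS H => w H a b Aa Bb; exact: H.
apply: cA => a Aa.
have H : \forall p \near nbhs (a : G, 1 : G), B `<=` (fun b => V (p.1 * p.2 * b)).
  apply: cB => b Bb.
  have Vab : nbhs (a * 1 * b) V.
    by rewrite mulg1; apply: open_nbhs_nbhs; split => //; apply: AB; exists a => //; exists b.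
  have : (fun q : G * (G * G) => q.2.1 * q.2.2 * q.1) @ nbhs (b, (a, 1 : G)) --> a * 1 * b.
    apply: mulg_cvg; last exact: cvg_fst.
    apply: mulg_cvg; apply: cvg_comp (@cvg_snd _ _ _ _ _) _; [exact: cvg_fst|exact: cvg_snd].
  by move=> /(_ _ Vab).
exact: H.
Qed.

Lemma compact_open_sub_translate A V : compact A -> open V -> A `<=` V ->
  \forall w \near (1 : G), forall a, A a -> V (a * w).
Proof.
move=> cA oV AV; have : mulset A [set 1] `<=` V.
  by move=> _ [a Aa [_ -> <-]]; rewrite mulg1; exact: AV.
move=> /(near_mulset cA (@compact_set1 _ _) oV).
by apply: filterS => w /(_ _ 1 _ erefl) H a Aa; have := H a Aa; rewrite mulg1.
Qed.

End TopologicalGroups.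

(** * Compact open neighbourhoods in totally disconnected spaces *)

Section CompactSeparation.
Variable T : topologicalType.
Implicit Types (A B C D K N : set T).

(** Separation from a filter passes from points to compact sets. Used for the
    neighbourhood filter of a point, then for that of a compact set, it separates two
    disjoint compact sets. *)
Lemma compact_filter_separation (F : set_system T) K : Filter F -> compact K ->
  (forall x, K x -> exists2 U, nbhs x U & exists2 W, F W & U `&` W = set0) ->
  exists2 W, F W & K `&` closure W = set0.
Proof.
move=> FF /compact_near_coveringP cK KF.
have [F0|nF0] := pselect (F set0).
  by exists set0 => //; rewrite closure0 setI0.
have PF : ProperFilter F by split.
have [D [DF _ [W DW]] DK] : \forall W \near powerset_filter_from F,
    K `<=` (fun x => ~ closure W x).
  apply: cK.
  move=> x /KF[U nU [W FW UW]].
  exists (U°, [set W' | F W' /\ W' `<=` W]).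
    by split=> /=; [exact: nbhs_interior|exact: powerset_filter_fromP].
  move=> [x' W'] [/= Ux' [_ W'W]] /(_ _ Ux')[y [W'y Uy]].
  by rewrite -[False]/(set0 y) -UW; split => //; exact: W'W.
exists W; first exact: DF.
by apply/seteqP; split => // x [Kx]; exact: DK.
Qed.

Lemma hausdorff_compact_separation A B : hausdorff_space T -> compact A ->
  compact B -> A `&` B = set0 ->
  exists2 V, open V & A `<=` V /\ B `&` closure V = set0.
Proof.
move=> hT cA cB AB0.
pose F : set_system T := [set V | forall a, A a -> nbhs a V].
have FF : Filter F.
  split; first by move=> a _; exact: filterT.
    by move=> P Q FP FQ a Aa; apply: filterI; [exact: FP|exact: FQ].
  by move=> P Q PQ FP a Aa; apply: filterS PQ _; exact: FP.
have [b Bb|W FW BW] := compact_filter_separation FF cB.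
  have [a Aa|W nW AW] := compact_filter_separation (nbhs_filter b) cA.
    have ab : a != b.
      by apply/eqP => ab; rewrite -[False]/(set0 a) -AB0; split => //; rewrite ab.
    move: (hT); rewrite open_hausdorff => /(_ _ _ ab)[[U W] /= []].
    rewrite !inE => Ua Wb [oU oW UW].
    exists U; first by apply: open_nbhs_nbhs; split.
    by exists W; [apply: open_nbhs_nbhs; split|].
  exists W => //; exists (~` closure W).
    move=> a Aa; apply: open_nbhs_nbhs; split.
      exact/closed_openC/closed_closure.
    by move=> cWa; rewrite -[False]/(set0 a) -AW.
  by apply/seteqP; split => // x [/subset_closure].
exists W°; first exact: open_interior.
split; first by move=> a /FW.
apply/seteqP; split => // x [Bx] /(closure_subset (@interior_subset _ W)) cWx.
by rewrite -BW.
Qed.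

(** The finite intersection property for a family that is stable under intersection; a
    cluster point of the filter it generates on [K] would lie in the intersection. *)
Lemma compact_directed_bigcap K (D : set (set T)) : compact K -> D !=set0 ->
  (forall F, D F -> closed F) ->
  (forall F F', D F -> D F' -> D (F `&` F')) ->
  K `&` \bigcap_(F in D) F = set0 -> exists2 F, D F & K `&` F = set0.
Proof.
move=> cK D0 Dcl DI KD; apply: contrapT => H.
have KF F : D F -> K `&` F !=set0.
  by move=> DF; apply/set0P/eqP => KF0; apply: H; exists F.
pose FF := filter_from D (fun F => K `&` F).
have fFF : Filter FF.
  apply: filter_from_filter => // F F' DF DF'; exists (F `&` F'); first exact: DI.
  by move=> x [Kx [Fx F'x]].
have pFF : ProperFilter FF := filter_from_proper fFF KF.
have [|x [Kx xFF]] := cK FF pFF.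
  by case: D0 => F DF; exists F => // x [].
rewrite -[False]/(set0 x) -KD; split => // F DF; apply: Dcl => // B nB.
have [|y [[]]] := xFF (K `&` F) B _ nB; first by exists F.
by move=> _ Fy By; exists y.
Qed.

(** In a compact Hausdorff space the intersection of the clopen neighbourhoods of a point
    is connected: two disjoint closed pieces of it have disjoint neighbourhoods, and by
    compactness these already split some clopen neighbourhood. The argument takes place
    inside a compact neighbourhood [C] of [x] for sets that are clopen relatively to [C].
    Total disconnectedness then reduces the intersection to [x], so some such set lies in
    the interior of [C], and it is therefore open. *)
Lemma compact_open_basis N (x : T) : hausdorff_space T ->
  locally_compact [set: T] -> totally_disconnected [set: T] ->
  open N -> N x -> exists V, [/\ compact V, open V, V x & V `<=` N].
Proof.
move=> hT lcT tdT oN Nx.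
have [C nC [cC clC]] : exists2 C, nbhs x C & compact C /\ closed C.
  by have [C + ?] := lcT x I; rewrite withinET => ?; exists C.
have cpt_closed := fun A : set T => @compact_closed T A hT.
pose D : set (set T) := [set F | [/\ closed F, closed (C `\` F), F `<=` C & F x]].
have DI F F' : D F -> D F' -> D (F `&` F').
  move=> [cF cCF FC Fx] [cF' cCF' F'C F'x]; split => //.
  - exact: closedI.
  - by rewrite setDIr; exact: closedU.
  - by move=> y [/FC].
have DC : D C by split => //; [rewrite setDv; exact: closed0|exact: nbhs_singleton].
pose Q := \bigcap_(F in D) F.
have QC : Q `<=` C by move=> y; apply.
have clQ : closed Q by apply: closed_bigI => F [].
have Qx : Q x by move=> F [].
have conQ : connected Q.
  move=> B [b Bb] [C1 oC1 BC1] [C2 cC2 BC2].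
  have cB : compact B.
    by apply: subclosed_compact cC _; rewrite BC2; [exact: closedI|move=> y [/QC]].
  have cQB : compact (Q `\` B).
    apply: subclosed_compact cC _; last by move=> y [/QC].
    have -> : Q `\` B = Q `&` ~` C1.
      by rewrite BC1; apply/seteqP; split=> y [Qy /= nB]; split => //;
        [move=> C1y; apply: nB|move=> [_ /nB]].
    by apply: closedI => //; exact: open_closedC.
  have [|V oV [BV QBV]] := hausdorff_compact_separation hT cB cQB.
    by apply/seteqP; split => // y [By []].
  have [|||||F [cF cCF FC Fx] KF] := @compact_directed_bigcap (C `&` (closure V `\` V)) D.
  - apply: compact_closedI => //; apply: closedI; first exact: closed_closure.
    exact: open_closedC.
  - by exists C.
  - by move=> F [].
  - exact: DI.
  - apply/seteqP; split => // y [[Cy [cVy nVy]] Qy].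
    rewrite -QBV; split => //; split => // By; exact/nVy/BV.
  have FV : F `&` V = F `&` closure V.
    apply/seteqP; split=> y [Fy Vy]; split => //; first exact: subset_closure.
    apply: contrapT => nVy; rewrite -[False]/(set0 y) -KF; split => //.
    by split => //; exact: FC.
  have FD : closed (F `&` V) /\ closed (F `\` V).
    rewrite {1}FV; split; apply: closedI => //; first exact: closed_closure.
    exact: open_closedC.
  have [Vx|nVx] := pselect (V x).
    have DFV : D (F `&` V).
      split => //; [by case: FD| |by move=> y [/FC]].
      have -> : C `\` (F `&` V) = (C `\` F) `|` (F `\` V).
        apply/seteqP; split=> [y [Cy nFV]|y [[Cy nF]|[Fy nV]]].
        - have [Fy|nFy] := pselect (F y); [right|by left].
          by split => // Vy; apply: nFV.
        - by split => // -[].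
        - by split; [exact: FC|case].
      by apply: closedU => //; case: FD.
    apply/seteqP; split=> [y|y Qy]; first by rewrite BC1 => -[].
    apply: contrapT => nBy; rewrite -[False]/(set0 y) -QBV; split => //.
    by apply: subset_closure; case: (Qy _ DFV).
  have DFV : D (F `\` V).
    split => //; [by case: FD| |by move=> y [/FC]].
    have -> : C `\` (F `\` V) = (C `\` F) `|` (F `&` V).
      apply/seteqP; split=> [y [Cy nFV]|y [[Cy nF]|[Fy Vy]]].
      - have [Fy|nFy] := pselect (F y); [right|by left].
        by split => //; apply: contrapT => nVy; apply: nFV.
      - by split => // -[].
      - by split; [exact: FC|case].
    by apply: closedU => //; case: FD.
  have Qb : Q b by move: Bb; rewrite BC1 => -[].
  by have [_] := Qb _ DFV; have := BV _ Bb.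
have Q1 : Q `<=` [set x].
  rewrite -(tdT x I) => y Qy; exists Q => //; split => //.
have [|||||F [cF cCF FC Fx] KF] := @compact_directed_bigcap (C `\` (N `&` C°)) D.
- apply: subclosed_compact cC _; last by move=> y [].
  apply: closedI => //; apply: open_closedC; apply: openI => //.
  exact: open_interior.
- by exists C.
- by move=> F [].
- exact: DI.
- apply/seteqP; split => // y [[Cy nNC] /Q1 yx]; apply: nNC.
  by rewrite yx; split => //; exact: nbhs_interior nC.
have FNC : F `<=` N `&` C°.
  move=> y Fy; apply: contrapT => nNC; rewrite -[False]/(set0 y) -KF; split => //.
  by split => //; exact: FC.
exists F; split => //; [exact: subclosed_compact cC FC| |by move=> y /FNC[]].
have -> : F = C° `&` ~` (C `\` F).
  apply/seteqP; split=> [y Fy|y [Cy nCF]].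
    by split; [case: (FNC _ Fy)|case].
  by apply: contrapT => nFy; apply: nCF; split => //; exact: interior_subset.
by apply: openI; [exact: open_interior|exact: closed_openC].
Qed.

End CompactSeparation.

(** * Compact open subgroups and their cosets *)

Section CompactOpenSubgroups.
Variable G : topologicalGroupType.
Implicit Types (A B C K L S T U V N : set G) (g h x y : G).
Local Open Scope group_scope.

Lemma nbhs_translate x (P : set G) : (\forall y \near (1 : G), P (x * y)) -> nbhs x P.
Proof.
move=> nP; have : (fun y : G => x^-1 * y) @ x --> x^-1 * x.
  exact: (@mulgl_continuous G x^-1 x).
rewrite mulVg => /(_ (fun y => P (x * y)) nP) H.
by rewrite (_ : P = fun z => P (x * (x^-1 * z))) //; apply/funext => z; rewrite mulVKg.
Qed.

Lemma near1V (P : set G) : (\forall y \near (1 : G), P y) -> \forall y \near (1 : G), P y^-1.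
Proof.
move=> nP; have : (fun y : G => y^-1) @ (1 : G) --> (1^-1 : G).
  exact: (@invg_continuous G 1).
by rewrite invg1 => /(_ P nP).
Qed.

Lemma subgroup_open L : is_subgroup L -> nbhs (1 : G) L -> open L.
Proof.
move=> sL nL; rewrite openE => x Lx; apply: nbhs_translate.
by apply: filterS nL => y Ly; exact: subgroupM.
Qed.

Lemma open_subgroup_closed L : is_subgroup L -> open L -> closed L.
Proof.
move=> sL oL; rewrite -[L]setCK; apply: open_closedC; rewrite openE => x nLx.
apply: nbhs_translate; have : nbhs (1 : G) L.
  by apply: open_nbhs_nbhs; split => //; exact: subgroup1.
by apply: filterS => y Ly; rewrite /setC/= subgroupMr.
Qed.

Definition compact_open_subgroup L := [/\ is_subgroup L, compact L & open L].

Lemma compact_open_subgroupI K L : hausdorff_space G ->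
  compact_open_subgroup K -> compact_open_subgroup L ->
  compact_open_subgroup (K `&` L).
Proof.
move=> hG [sK cK oK] [sL cL oL]; split; [exact: subgroupI| |exact: openI].
by apply: compact_closedI => //; exact: compact_closed.
Qed.

Hypotheses (lcG : locally_compact_group G) (tdG : totally_disconnected [set: G]).

(** Van Dantzig's theorem. If [V] is a compact open neighbourhood of 1, the elements [g]
    with [V g] and [V g^-1] inside [V] form a subgroup; it contains a neighbourhood of 1
    by the tube lemma, and it lies in [V] because 1 does. *)
Lemma compact_open_subgroup_basis (P : set G) : nbhs (1 : G) P ->
  exists2 L, compact_open_subgroup L & L `<=` P.
Proof.
case: lcG => hG lG nP.
have [V [cV oV V1 VP]] := compact_open_basis hG lG tdG
  (@open_interior _ P) nP.
have nW := compact_open_sub_translate cV oV (@subset_refl _ V).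
pose L := [set g | (forall a, V a -> V (a * g)) /\ (forall a, V a -> V (a * g^-1))].
have sL : is_subgroup L.
  split; first by split => a; rewrite ?invg1 mulg1.
  move=> x y [Lx LVx] [Ly LVy]; split => a Va; first by rewrite mulgA; exact/LVy/Lx.
  by rewrite invgM invgK mulgA; exact/LVx/Ly.
have oL : open L.
  by apply: subgroup_open => //; apply: filterI; [exact: nW|exact: (near1V nW)].
have LV : L `<=` V by move=> x [/(_ 1 V1)]; rewrite mul1g.
exists L; last by move=> x /LV/VP; exact: interior_subset.
split => //; apply: subclosed_compact cV LV; exact: open_subgroup_closed.
Qed.

Lemma compact_open_right_invariant C : compact C -> open C ->
  exists2 L, compact_open_subgroup L & mulset C L `<=` C.
Proof.
move=> cC oC; have nW := compact_open_sub_translate cC oC (@subset_refl _ C).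
have [L cosL LW] := compact_open_subgroup_basis nW.
by exists L => // _ [c Cc [l Ll <-]]; exact: LW.
Qed.

(** The fibres are clopen and disjoint, so finitely many of them cover [A]. *)
Lemma finite_image_compact (X : choiceType) (phi : G -> X) A : compact A ->
  (forall x : X, open (phi @^-1` [set x])) -> finite_set (phi @` A).
Proof.
move=> cA ophi.
have opre (B : set X) : open (phi @^-1` B).
  have -> : phi @^-1` B = \bigcup_(x in B) phi @^-1` [set x].
    by apply/seteqP; split=> [g Bg|g [x Bx /= ->]//]; exists (phi g).
  by apply: bigcup_open => x _; exact: ophi.
have [||||_ [B fB <-] AB] := @compact_directed_bigcap _ A
    [set phi @^-1` (~` B) | B in finite_set] cA.
- by exists (phi @^-1` (~` set0)); exists set0; first exact: finite_set0.
- by move=> _ [B _ <-]; rewrite -[_ @^-1` _]preimage_setC; exact: open_closedC.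
- move=> _ _ [B fB <-] [B' fB' <-]; exists (B `|` B').
    by rewrite /= finite_setU.
  by rewrite setCU preimage_setI.
- apply/seteqP; split => // g [Ag H].
  suff /H : [set phi @^-1` (~` B) | B in finite_set] (phi @^-1` (~` [set phi g])).
    exact.
  by exists [set phi g]; first exact: finite_set1.
apply: sub_finite_set fB => _ [g Ag <-]; apply: contrapT => nB.
by rewrite -[False]/(set0 g) -AB.
Qed.

(** [phi] induces an injection of [G / L] into [X]. Orbit maps and quotient maps are both
    of this form, which lets one counting argument serve both. *)
Definition coset_map (X : Type) (phi : G -> X) L :=
  forall g h, phi g = phi h <-> L (g^-1 * h).

Section CosetMap.
Variables (X : choiceType) (phi : G -> X) (L : set G).
Hypotheses (cosL : compact_open_subgroup L) (phiL : coset_map phi L).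

Lemma coset_map_fiber g : phi @^-1` [set phi g] = ltranslate g L.
Proof.
by rewrite ltranslateE; apply/seteqP; split=> h /=; [move=> /esym/phiL|move=> /phiL].
Qed.

Lemma coset_map_open (x : X) : open (phi @^-1` [set x]).
Proof.
have [[g _ <-]|H] := pselect (range phi x).
  by rewrite coset_map_fiber; apply: open_ltranslate; case: cosL.
rewrite (_ : _ @^-1` _ = set0); first exact: open0.
by apply/seteqP; split => // g /= gx; apply: H; exists g.
Qed.

Lemma coset_map_preimage_open (B : set X) : open (phi @^-1` B).
Proof.
have -> : phi @^-1` B = \bigcup_(x in B) phi @^-1` [set x].
  by apply/seteqP; split=> [g Bg|g [x Bx /= ->]//]; exists (phi g).
by apply: bigcup_open => x _; exact: coset_map_open.
Qed.

Lemma coset_map_preimage_compact (B : set X) : finite_set B -> compact (phi @^-1` B).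
Proof.
move=> fB; have -> : phi @^-1` B = \bigcup_(x in B) phi @^-1` [set x].
  by apply/seteqP; split=> [g Bg|g [x Bx /= ->]//]; exists (phi g).
rewrite -bigsetU_fset_set//; apply: bigsetU_compact => x _.
have [[g _ <-]|H] := pselect (range phi x).
  by rewrite coset_map_fiber; apply: compact_ltranslate; case: cosL.
rewrite (_ : _ @^-1` _ = set0); first exact: compact0.
by apply/seteqP; split => // g /= gx; apply: H; exists g.
Qed.

Lemma coset_map_image_finite A : compact A -> finite_set (phi @` A).
Proof. by move=> cA; apply: finite_image_compact cA _; exact: coset_map_open. Qed.

Lemma coset_map_preimage_image A : phi @^-1` (phi @` A) = mulset A L.
Proof.
apply/seteqP; split=> [g [a Aa /phiL Lag]|_ [a Aa [l Ll <-]]].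
  by exists a => //; exists (a^-1 * g) => //; rewrite mulVKg.
by exists a => //; apply/phiL; rewrite mulKg.
Qed.

End CosetMap.

Lemma coset_map_ltranslate L : is_subgroup L -> coset_map (fun g => ltranslate g L) L.
Proof. by move=> sL g h; exact: subgroup_ltranslate_eq. Qed.

End CompactOpenSubgroups.

(** * Haar volume *)

Section HaarVolume.
Variables (R : realType) (G : topologicalGroupType).
Variable mu : {measure set (borel G) -> \bar R}.
Hypotheses (lcG : locally_compact_group G) (tdG : totally_disconnected [set: G]).
Hypothesis (haar_mu : left_haar_measure mu).
Implicit Types (A B C K L S T U V N : set G) (g h x y : G).

Definition vol A : R := fine (mu A).

Definition borel_set A := measurable (A : set (borel G)).

Lemma borel_open A : open A -> borel_set A.
Proof. exact: sub_sigma_algebra. Qed.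

Lemma borel_compact A : compact A -> borel_set A.
Proof.
case: lcG => hG _ cA; rewrite /borel_set -[A]setCK.
by apply: measurableC; apply: borel_open; apply: closed_openC; exact: compact_closed.
Qed.

(** Sets of finite measure for the reason that they are relatively compact; on them the
    real-valued [vol] carries all the information of the measure. *)
Definition bounded_borel A := borel_set A /\ exists2 C, compact C & A `<=` C.

Lemma bounded_borel_compact A : compact A -> bounded_borel A.
Proof. by move=> cA; split; [exact: borel_compact|exists A]. Qed.

Lemma bounded_borelD A B : bounded_borel A -> bounded_borel B -> bounded_borel (A `\` B).
Proof.
move=> [mA [C cC AC]] [mB _]; split; first exact: measurableD.
by exists C => // x [/AC].
Qed.

Lemma bounded_borelI A B : bounded_borel A -> bounded_borel B -> bounded_borel (A `&` B).
Proof.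
move=> [mA [C cC AC]] [mB _]; split; first exact: measurableI.
by exists C => // x [/AC].
Qed.

Lemma bounded_borelU A B : bounded_borel A -> bounded_borel B -> bounded_borel (A `|` B).
Proof.
move=> [mA [C cC AC]] [mB [D cD BD]]; split; first exact: measurableU.
by exists (C `|` D); [exact: compactU|move=> x [/AC|/BD]; [left|right]].
Qed.

Lemma vol_ge0 A : 0 <= vol A.
Proof. by rewrite fine_ge0. Qed.

Lemma muE A : bounded_borel A -> mu A = (vol A)%:E.
Proof.
move=> [mA [C cC AC]]; rewrite fineK// ge0_fin_numE//.
case: haar_mu => _ /(_ _ cC) muC _ _ _; apply: le_lt_trans muC.
by apply: le_measure; rewrite ?inE//; exact: borel_compact.
Qed.

Lemma vol_le A B : bounded_borel A -> bounded_borel B -> A `<=` B -> vol A <= vol B.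
Proof.
move=> tA tB AB; rewrite -lee_fin -!muE//.
by apply: le_measure; rewrite ?inE//; [case: tA|case: tB].
Qed.

Lemma volD A B : bounded_borel A -> bounded_borel B -> vol A = vol (A `\` B) + vol (A `&` B).
Proof.
move=> tA tB; apply: EFin_inj.
rewrite EFinD -!muE//; [|exact: bounded_borelI|exact: bounded_borelD].
by apply: measureDI; [case: tA|case: tB].
Qed.

Lemma vol_setD_sub A B : bounded_borel A -> bounded_borel B -> B `<=` A ->
  vol (A `\` B) = vol A - vol B.
Proof.
by move=> tA tB BA; rewrite (volD tA tB) (_ : A `&` B = B) ?addrK//; exact/setIidPr.
Qed.

Lemma vol_setU_le A B : bounded_borel A -> bounded_borel B -> vol (A `|` B) <= vol A + vol B.
Proof.
move=> tA tB; rewrite (volD (bounded_borelU tA tB) tA) addrC.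
have -> : (A `|` B) `&` A = A by rewrite setUK.
rewrite lerD2l; apply: vol_le => //; last by move=> x [[]].
by apply: bounded_borelD => //; exact: bounded_borelU.
Qed.

Lemma mu_ltranslate g A : borel_set A -> mu (ltranslate g A) = mu A.
Proof. by case: haar_mu => H _ _ _ _; exact: H. Qed.

Lemma vol_ltranslate g A : borel_set A -> vol (ltranslate g A) = vol A.
Proof. by move=> mA; rewrite /vol mu_ltranslate. Qed.

Section Cosets.
Variables (X : choiceType) (phi : G -> X) (L : set G).
Hypotheses (cosL : compact_open_subgroup L) (phiL : coset_map phi L).

(** The preimage is a disjoint union of [#B] left translates of [L]. *)
Lemma vol_coset_map_preimage (B : set X) : finite_set B -> B `<=` range phi ->
  vol (phi @^-1` B) = (#|` fset_set B|)%:R * vol L.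
Proof.
move=> fB Br; have -> : phi @^-1` B = \bigcup_(x in B) phi @^-1` [set x].
  by apply/seteqP; split=> [g Bg|g [x Bx /= ->]//]; exists (phi g).
have tL : bounded_borel L by apply: bounded_borel_compact; case: cosL.
have mufib (x : X) : B x -> mu (phi @^-1` [set x]) = (vol L)%:E.
  move=> /Br[g _ <-]; rewrite (coset_map_fiber phiL) mu_ltranslate; last by case: tL.
  exact: muE.
rewrite /vol measure_fin_bigcup//; last first.
- by move=> x _; apply: borel_open; exact: coset_map_open cosL phiL x.
- by move=> x y _ _ [g [/= <- <-]].
rewrite fsbig_finite//= (eq_big_seq (fun=> (vol L)%:E)); last first.
  by move=> x; rewrite in_fset_set// inE => /mufib.
by rewrite sumEFin/= big_const_seq count_predT iter_addr_0 mulr_natl.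
Qed.

End Cosets.

(** Some compact set has positive measure by inner regularity, and finitely many left
    translates of a compact open subgroup inside [a^-1 A] cover it. *)
Lemma vol_gt0 A : bounded_borel A -> open A -> A !=set0 -> 0 < vol A.
Proof.
move=> tA oA [a Aa].
have [K cK muK] : exists2 K, compact K & (0 < mu K)%E.
  apply: contrapT => H; case: haar_mu => _ _ _ /(_ _ (@openT G)) muT.
  move/negP; apply; rewrite eq_le measure_ge0 andbT muT.
  apply: ub_ereal_sup => _ [K [cK _] <-]; rewrite leNgt; apply/negP => muK.
  by apply: H; exists K.
have nA : \forall w \near (1%g : G), A (a * w)%g.
  by apply: nearM1; exact: open_nbhs_nbhs.
have [L cosL LA] := compact_open_subgroup_basis lcG tdG nA.
have [sL cL oL] := cosL.
have phiL := coset_map_ltranslate sL.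
have tL := bounded_borel_compact cL.
have L0 : 0 < vol L.
  rewrite lt_neqAle vol_ge0 andbT eq_sym; apply/eqP => L0.
  have fB := coset_map_image_finite cosL phiL cK.
  have := vol_coset_map_preimage cosL phiL fB (image_subset _ (@subsetT _ K)).
  rewrite L0 mulr0 => V0.
  have tV := bounded_borel_compact (coset_map_preimage_compact cosL phiL fB).
  move: muK; rewrite (muE (bounded_borel_compact cK)) lte_fin ltNge -V0 => /negP; apply.
  by apply: vol_le => //; [exact: bounded_borel_compact|exact: preimage_image].
rewrite (lt_le_trans L0)// -(vol_ltranslate a); last by case: tL.
apply: vol_le => //; first by apply: bounded_borel_compact; exact: compact_ltranslate.
by move=> _ [l Ll <-]; exact: LA.
Qed.

End HaarVolume.

(** * Graphs: pigeonhole, Cheeger constants, Lipschitz orbit maps *)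

Section Averaging.
Variable R : realType.

(** If every index with [0 < b i] violated the conclusion, the sums would compare strictly
    in the other direction. *)
Lemma exists_le_of_sum_le (I : eqType) (s : seq I) (a b : I -> R) (c : R) :
  (forall i, i \in s -> 0 <= a i) -> (forall i, i \in s -> 0 <= b i) ->
  \sum_(i <- s) a i <= c * \sum_(i <- s) b i -> 0 < \sum_(i <- s) b i ->
  exists2 i, i \in s & 0 < b i /\ a i <= c * b i.
Proof.
move=> a0 b0; rewrite mulr_sumr => ab; rewrite lt0r => /andP[/eqP nb _].
apply: contrapT => H; apply: nb.
have cba i : i \in s -> 0 < b i -> c * b i < a i.
  by move=> si bi; rewrite ltNge; apply/negP => ai; apply: H; exists i.
have le i : i \in s -> c * b i <= a i.
  move=> si; have := b0 _ si; rewrite le_eqVlt => /predU1P[<-|/(cba _ si)/ltW//].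
  by rewrite mulr0 a0.
rewrite big_seq big1// => i si; apply/eqP; rewrite eq_le (b0 _ si) andbT leNgt.
apply/negP => /(cba _ si) lti.
have : \sum_(i <- s) (a i - c * b i) <= 0 by rewrite sumrB subr_le0.
rewrite leNgt => /negP; apply; rewrite big_seq.
rewrite lt_neqAle sumr_ge0 ?andbT; last by move=> j sj; rewrite subr_ge0 le.
rewrite eq_sym psumr_neq0; last by move=> j sj; rewrite subr_ge0 le.
by apply/hasP; exists i => //; rewrite si subr_gt0.
Qed.

Definition card_set (T : choiceType) (A : set T) : nat := #|` fset_set A|.

Lemma countingE (T : choiceType) (A : set T) : finite_set A ->
  counting A = (card_set A)%:R%:E :> \bar R.
Proof. by move=> fA; rewrite /counting asboolT. Qed.

Lemma card_set_gt0 (T : choiceType) (A : set T) : finite_set A -> A !=set0 ->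
  (0 < card_set A)%N.
Proof.
move=> fA [x Ax]; rewrite cardfs_gt0; apply/fset0Pn; exists x.
by rewrite in_fset_set// inE.
Qed.

Lemma card_set_fiber (T Y : choiceType) (f : T -> Y) (A : set T) y : finite_set A ->
  card_set (A `&` f @^-1` [set y]) = count (fun x => f x == y) (fset_set A).
Proof.
move=> fA; rewrite -size_filter; apply: perm_size; apply: uniq_perm => //.
  by rewrite filter_uniq.
have fB : finite_set (A `&` f @^-1` [set y]) by apply: sub_finite_set fA => x [].
move=> x; rewrite mem_filter !in_fset_set// in_setI andbC; congr andb.
by apply/idP/eqP; rewrite inE.
Qed.

Lemma sum_card_fiber (T Y : choiceType) (f : T -> Y) (s : seq Y) (A : set T) :
  finite_set A -> uniq s ->
  (\sum_(y <- s) card_set (A `&` f @^-1` [set y]) =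
   count (fun x => f x \in s) (fset_set A))%N.
Proof.
move=> fA us; under eq_bigr do rewrite card_set_fiber//.
rewrite -sum1_count; under eq_bigr do rewrite -sum1_count big_mkcond.
rewrite exchange_big/= [RHS]big_mkcond; apply: eq_bigr => x _.
rewrite -big_mkcond sum1_count; under eq_count do rewrite eq_sym.
by rewrite -[RHS]/(nat_of_bool (f x \in s)) -count_uniq_mem.
Qed.

(** The fibres of [f] that meet [A] exhaust [A], while they may miss part of [B]. *)
Lemma exists_fiber_card_le (T Y : choiceType) (f : T -> Y) (A B : set T) (c : R) :
  finite_set A -> finite_set B -> A !=set0 ->
  (card_set B)%:R <= c * (card_set A)%:R ->
  exists2 a, A a & (card_set (B `&` f @^-1` [set f a]))%:R <=
                   c * (card_set (A `&` f @^-1` [set f a]))%:R.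
Proof.
move=> fA fB A0 BA; pose s := undup [seq f x | x <- fset_set A].
have us : uniq s by rewrite undup_uniq.
have sA : (\sum_(y <- s) card_set (A `&` f @^-1` [set y]) = card_set A)%N.
  rewrite sum_card_fiber//; apply/eqP; rewrite -all_count; apply/allP => x Ax.
  by rewrite mem_undup map_f.
have sB : (\sum_(y <- s) card_set (B `&` f @^-1` [set y]) <= card_set B)%N.
  by rewrite sum_card_fiber//; exact: count_size.
have [||||y sy [Ay By]] := @exists_le_of_sum_le _ s
  (fun y => (card_set (B `&` f @^-1` [set y]))%:R)
  (fun y => (card_set (A `&` f @^-1` [set y]))%:R) c.
- by move=> *; exact: ler0n.
- by move=> *; exact: ler0n.
- by rewrite -!natr_sum sA (le_trans _ BA)// ler_nat.
- by rewrite -natr_sum sA ltr0n card_set_gt0.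
move: sy; rewrite mem_undup => /mapP[a]; rewrite in_fset_set// inE => Aa yfa.
by exists a => //; rewrite -yfa.
Qed.

End Averaging.

Section Graphs.
Variables (R : realType) (Gamma : simple_graph).

Lemma boundary_finite (A : set Gamma) : locally_finite Gamma -> finite_set A ->
  finite_set (boundary A).
Proof.
move=> lfG fA; apply: (@sub_finite_set _ _ (\bigcup_(x in A) [set y | adj x y])).
  by move=> y [_ [x Ax xy]]; exists x.
by apply: bigcup_finite => // x _; exact: lfG.
Qed.

Lemma boundary_ratioE (A : set Gamma) : locally_finite Gamma -> finite_set A ->
  A !=set0 -> (counting (boundary A) / counting A)%E =
  ((card_set (boundary A))%:R / (card_set A)%:R)%:E :> \bar R.
Proof.
move=> lfG fA A0; rewrite !countingE//; last exact: boundary_finite.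
by rewrite inver pnatr_eq0 (gtn_eqF (card_set_gt0 fA A0)).
Qed.

Lemma amenable_graphP : locally_finite Gamma -> amenable_graph R Gamma <->
  forall d : R, 0 < d -> exists A : set Gamma, [/\ finite_set A, A !=set0
    & (card_set (boundary A))%:R <= d * (card_set A)%:R].
Proof.
move=> lfG; split=> [aG d d0|H].
  have : (cheeger R Gamma < d%:E)%E by rewrite aG lte_fin.
  move=> /ereal_inf_lt[_ [A [fA A0] <-]]; rewrite boundary_ratioE// lte_fin => /ltW.
  by rewrite ler_pdivrMr ?ltr0n ?card_set_gt0// => ?; exists A.
apply/eqP; rewrite eq_le; apply/andP; split; last first.
  apply: le_ereal_inf_tmp => _ [A [fA A0] <-].
  by rewrite boundary_ratioE// lee_fin divr_ge0.
apply/lee_addgt0Pr => d d0; rewrite add0e.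
have [A [fA A0 Ad]] := H d d0.
apply: ge_ereal_inf; exists (counting (boundary A) / counting A)%E; first by exists A.
by rewrite boundary_ratioE// lee_fin ler_pdivrMr ?ltr0n ?card_set_gt0.
Qed.

End Graphs.

Section Lipschitz.
Variables (R : realType) (G : topologicalGroupType) (Gamma : simple_graph).
Variable act : G -> Gamma -> Gamma.
Hypothesis (actG : graph_action act).

(** A word of length [n] in [S] from [g] to [h] is carried to a walk from [g x] to [h x],
    because [g s x] and [g x] are the images of [s x] and [x] under an automorphism. *)
Lemma orbit_mapP (S : set G) x : orbit_map_lipschitz (1 : R) act S x <->
  forall s, S s -> act s x = x \/ adj x (act s x).
Proof.
have [act1 actM actA _] := actG.
split=> [lip s Ss|H g h].
  have := lip 1%g s; rewrite mul1e act1 => xs.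
  have : (graph_dist R x (act s x) < 2%:E)%E.
    apply: (le_lt_trans xs); apply: (@le_lt_trans _ _ 1%:E); last first.
      by rewrite lte_fin; lra.
    apply: ge_ereal_inf; exists 1%:E => //; exists [:: s] => //; split.
      by move=> y; rewrite inE => /eqP ->.
    by rewrite big_seq1 invg1 mul1g.
  move=> /ereal_inf_lt[_ [p [px lpx] <-]]; rewrite lte_fin ltr_nat.
  case: p px lpx => [_ /= <-|z [|//]]; first by left.
  by rewrite /= andbT => xz <- _; right.
rewrite mul1e; apply: le_ereal_inf_tmp => _ [p [Sp pgh] <-].
apply: ge_ereal_inf.
have {pgh} -> : h = (g * \big[*%g/1%g]_(x <- p) x)%g by rewrite pgh mulVKg.
elim: p g Sp => [|s p IH] g Sp.
  by exists 0%:E => //; exists [::] => //; split; rewrite // big_nil mulg1.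
have [_ [q [gq lq] <-] qp] := IH (g * s)%g (fun x xp => Sp x (mem_behead (s := s :: p) xp)).
rewrite big_cons mulgA.
have [sx|sx] := H s (Sp s (mem_head s p)).
  exists (size q)%:R%:E; last by rewrite (le_trans qp)// lee_fin ler_nat/= leqnSn.
  by exists q => //; move: gq lq; rewrite !actM sx.
exists (size (act (g * s)%g x :: q))%:R%:E; last by move: qp; rewrite !lee_fin !ler_nat.
by exists (act (g * s)%g x :: q) => //=; split=> //; rewrite gq andbT actM actA.
Qed.

End Lipschitz.

Section Stabilisers.
Variables (G : topologicalGroupType) (Gamma : simple_graph).
Variable act : G -> Gamma -> Gamma.
Hypothesis (actG : proper_action act).

(** Openness is the continuity of the action: evaluation at [x] is continuous with values
    in a discrete space. *)
Lemma stabiliser_compact_open x : compact_open_subgroup (stabiliser act x).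
Proof.
have [[act1 actM _ actC] cst] := actG.
have sst : is_subgroup (stabiliser act x).
  split; first exact: act1.
  move=> g h /= gx hx; rewrite /stabiliser/= actM.
  have : act (h^-1)%g (act h x) = x by rewrite -actM mulVg act1.
  by rewrite hx => ->.
split => //; apply: subgroup_open => //.
have : (fun g => act g x : discrete_topology Gamma) @ (1%g : G) --> (act 1%g x : discrete_topology Gamma).
  apply: (@cvg_comp _ _ _ (act : G -> {ptws Gamma -> discrete_topology Gamma})
    (fun f : {ptws Gamma -> discrete_topology Gamma} => f x)).
    exact: actC.
  exact: (@proj_continuous _ (fun _ : Gamma => discrete_topology Gamma) x).
by rewrite act1 => /(_ _ (discrete_set1 _)).
Qed.

Lemma orbit_coset_map x : coset_map (fun g => act g x) (stabiliser act x).
Proof.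
have [[act1 actM _ _] _] := actG.
move=> g h; rewrite /stabiliser /= actM; split=> [<-|E].
  by rewrite -actM mulVg act1.
have : act g (act (g^-1)%g (act h x)) = act h x by rewrite -actM mulgV act1.
by rewrite E.
Qed.

End Stabilisers.

(** * Amenable graphs give Følner sets *)

Section Folner.
Variables (R : realType) (G : topologicalGroupType).
Variable mu : {measure set (borel G) -> \bar R}.
Hypotheses (lcG : locally_compact_group G) (tdG : totally_disconnected [set: G]).
Hypothesis (haar_mu : left_haar_measure mu).
Implicit Types (A B C K L S T U V N : set G) (g h x y : G).
Local Notation vol := (vol mu).


Lemma mu_gt0E A : bounded_borel A -> (0 < mu A)%E = (0 < vol A).
Proof. by move=> tA; rewrite muE// lte_fin. Qed.

Lemma mu_ratioE A U : bounded_borel A -> bounded_borel U -> 0 < vol U ->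
  (mu A / mu U)%E = (vol A / vol U)%:E.
Proof. by move=> tA tU U0; rewrite !muE// inver gt_eqF. Qed.

Lemma geometrically_amenableP : geometrically_amenable mu <->
  forall K, compact K -> forall e : R, 0 < e -> exists U,
    [/\ compact U, 0 < vol U & vol (mulset U K) <= (1 + e) * vol U].
Proof.
split=> H K cK e e0; have [U [cU U0 UK]] := H K cK e e0; exists U; split => //.
- by rewrite -mu_gt0E//; exact: bounded_borel_compact.
- have tU := bounded_borel_compact lcG cU.
  have tUK := bounded_borel_compact lcG (compact_mulset cU cK).
  move: U0 UK; rewrite mu_gt0E// => U0; rewrite mu_ratioE// lee_fin.
  by rewrite ler_pdivrMr.
- by rewrite mu_gt0E//; exact: bounded_borel_compact.
- have tU := bounded_borel_compact lcG cU.
  have tUK := bounded_borel_compact lcG (compact_mulset cU cK).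
  by rewrite mu_ratioE// lee_fin ler_pdivrMr.
Qed.

Lemma folner_star0P : folner_star mu = 0%E <->
  forall e : R, 0 < e -> exists S U, [/\ compact_symmetric_generating S,
    compact U, 0 < vol U & vol (mulset U S `\` U) <= e * vol U].
Proof.
have rE S U : compact S -> compact U -> 0 < vol U ->
    (mu (mulset U S `\` U) / mu U)%E = (vol (mulset U S `\` U) / vol U)%:E.
  move=> cS cU U0; apply: mu_ratioE => //; last exact: bounded_borel_compact.
  by apply: bounded_borelD; apply: bounded_borel_compact => //; exact: compact_mulset.
split=> [F0 e e0|H].
  have : (folner_star mu < e%:E)%E by rewrite F0 lte_fin.
  move=> /ereal_inf_lt[_ [S Sgen <-]] /ereal_inf_lt[_ [U [cU U0] <-]].
  move: U0; rewrite mu_gt0E; last exact: bounded_borel_compact.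
  move=> U0; have cS : compact S by case: Sgen.
  by rewrite rE// lte_fin ltr_pdivrMr// => /ltW ?; exists S, U.
apply/eqP; rewrite eq_le; apply/andP; split; last first.
  apply: le_ereal_inf_tmp => _ [S [cS _ _] <-].
  apply: le_ereal_inf_tmp => _ [U [cU U0] <-].
  move: U0; rewrite mu_gt0E; last exact: bounded_borel_compact.
  by move=> U0; rewrite rE// lee_fin divr_ge0// ?vol_ge0// ltW.
apply/lee_addgt0Pr => e e0; rewrite add0e.
have [S [U [Sgen cU U0 Ue]]] := H e e0; have cS : compact S by case: Sgen.
apply: ge_ereal_inf; eexists; first by exists S.
apply: ge_ereal_inf; exists (mu (mulset U S `\` U) / mu U)%E.
  by exists U => //; split => //; rewrite mu_gt0E//; exact: bounded_borel_compact.
by rewrite rE// lee_fin ler_pdivrMr.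
Qed.

Section Action.
Variables (Gamma : simple_graph) (act : G -> Gamma -> Gamma).
Hypotheses (lfG : locally_finite Gamma) (aG : amenable_graph R Gamma)
  (pG : proper_action act).

Lemma orbit_eq (x y : Gamma) : orbit act y x -> orbit act x = orbit act y.
Proof.
have [[act1 actM _ _] _] := pG.
move=> [g _ <-]; apply/seteqP; split=> [_ [h _ <-]|_ [h _ <-]].
  by exists (h * g)%g => //; rewrite actM.
by exists (h * g^-1)%g => //; rewrite -actM mulgVK.
Qed.

(** [S] is quantified after the orbit of [y]: in a contingently Lipschitz action it may
    depend on the orbit, and the orbit depends on [d]. *)
Lemma amenable_action_folner (d : R) : 0 < d -> exists y : Gamma,
  forall (x : Gamma) S, compact S -> orbit act y x -> orbit_map_lipschitz (1 : R) act S x ->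
  exists U, [/\ compact U, open U, U !=set0
              & vol (mulset U S `\` U) <= d * vol U].
Proof.
have [actG _] := pG; have [act1 actM actA _] := actG.
move=> d0; have [A [fA A0 Ad]] := (amenable_graphP R lfG).1 aG d d0.
have fB := boundary_finite lfG fA.
have [y Ay yd] := @exists_fiber_card_le R Gamma (set Gamma) (orbit act) _ _ _ fA fB A0 Ad.
exists y => x S cS yx Sx; have Oyx := orbit_eq yx.
pose phi g := act g x; pose L := stabiliser act x.
have cosL := stabiliser_compact_open pG x : compact_open_subgroup L.
have phiL := orbit_coset_map pG x : coset_map phi L.
pose fib (B : set Gamma) := B `&` orbit act @^-1` [set orbit act y].
have fibr (B : set Gamma) : fib B `<=` range phi.
  move=> z [_ /= zy]; have : orbit act z z by exists 1%g.
  by rewrite zy -Oyx => -[g _ <-]; exists g.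
have prefib (B : set Gamma) : phi @^-1` (fib B) = phi @^-1` B.
  apply/seteqP; split=> [g []//|g Bg]; split => //=.
  by rewrite -Oyx; apply: orbit_eq; exists g.
have finfib (B : set Gamma) : finite_set B -> finite_set (fib B).
  by move=> fB'; apply: sub_finite_set fB' => z [].
have volfib (B : set Gamma) : finite_set B ->
    vol (phi @^-1` B) = (card_set (fib B))%:R * vol L.
  move=> fB'; rewrite -prefib; exact: vol_coset_map_preimage (finfib _ fB') (fibr B).
have cU := coset_map_preimage_compact cosL phiL fA.
have cW := coset_map_preimage_compact cosL phiL fB.
exists (phi @^-1` A); split => //.
- exact: coset_map_preimage_open cosL phiL A.
- have /fibr[g _ gy] : fib A y by [].
  by exists g; rewrite /= gy.
have tU := bounded_borel_compact lcG cU.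
apply: (@le_trans _ _ (vol (phi @^-1` boundary A))).
  apply: vol_le => //; last 1 first.
  - move=> _ [[g Ag [s Ss <-]] nA]; split => //.
    exists (act g x) => //; move: nA; rewrite /phi /= !actM actA => nA.
    by have [sx|//] := (orbit_mapP R actG S x).1 Sx s Ss; move: nA; rewrite sx.
  - by apply: bounded_borelD => //; apply: bounded_borel_compact => //; exact: compact_mulset.
  - exact: bounded_borel_compact.
rewrite !volfib// mulrA ler_wpM2r// vol_ge0//.
Qed.

End Action.

Lemma contingently_lipschitz_folner_star0 :
  (exists (Gamma : simple_graph) (act : G -> Gamma -> Gamma),
     [/\ locally_finite Gamma, amenable_graph R Gamma, proper_action act
       & contingently_lipschitz_action (1 : R) act]) ->
  folner_star mu = 0%E.
Proof.
move=> [Gamma [act [lfG aG pG lipG]]]; apply/folner_star0P => e e0.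
have [x Hx] := amenable_action_folner lfG aG pG e0.
have [S Sgen Sx] := lipG x; have cS : compact S by case: Sgen.
have [|U [cU oU U0 Ue]] := Hx x S cS _ Sx.
  by have [[act1 _ _ _] _] := pG; exists 1%g.
exists S, U; split => //; apply: vol_gt0 => //; exact: bounded_borel_compact.
Qed.

End Folner.

(** * Coset graphs *)

Section CosetGraph.
Variables (G : topologicalGroupType) (K S : nat -> set G).
Hypothesis (cosK : forall n, compact_open_subgroup (K n)).
Hypothesis (cS : forall n, compact (S n)).
Hypothesis (symS : forall n x, S n x -> S n (x^-1)%g).
Implicit Types (g h : G) (n : nat).

(** The coset [g (K n)] is recorded as a set, paired with [n] since one subset of [G] may
    be a coset for several indices. *)
Definition coset_vertex : Type :=
  {v : nat * set G | `[< exists g, v.2 = ltranslate g (K v.1) >]}.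
HB.instance Definition _ := Choice.on coset_vertex.

Implicit Types v w : coset_vertex.

Definition coset n g : coset_vertex :=
  exist _ (n, ltranslate g (K n)) (asboolT (ex_intro _ g erefl)).

(** For [v] the coset of [g] and [w] the coset of [h], the last condition says that
    [g^-1 h] lies in [K S K]. *)
Definition coset_adj v w : bool :=
  `[< [/\ (val v).1 = (val w).1, v <> w & exists g h,
          [/\ (val v).2 g, (val w).2 h & S (val v).1 (g^-1 * h)%g]] >].

Lemma coset_adj_sym : symmetric coset_adj.
Proof.
suff H v w : coset_adj v w -> coset_adj w v by move=> v w; apply/idP/idP; exact: H.
move=> /asboolP[vw nvw [g [h [vg wh Sgh]]]]; apply/asboolP; split=> //.
  by move=> /esym.
exists h, g; split => //; rewrite -vw.
by have := symS Sgh; rewrite invgM invgK.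
Qed.

Lemma coset_adj_irrefl : irreflexive coset_adj.
Proof. by move=> v; apply/asboolPn => -[]. Qed.

Definition coset_graph := SimpleGraph coset_adj_sym coset_adj_irrefl.

Lemma cosetP v : exists n g, v = coset n g.
Proof.
case: v => -[n A] /= p; have /asboolP[g /= Ag] := p.
by exists n, g; apply: val_inj => /=; rewrite Ag.
Qed.

Lemma coset_coset_map n : coset_map (coset n) (K n).
Proof.
have [sK _ _] := cosK n; move=> g h; rewrite -(coset_map_ltranslate sK g h).
by split=> [[]//|E]; apply: val_inj; rewrite /= E.
Qed.

Lemma mem_coset n g h : (val (coset n g)).2 h <-> coset n g = coset n h.
Proof. by rewrite /= coset_coset_map ltranslateE. Qed.

Lemma coset_adjP n g w : coset_adj (coset n g) w <->
  [/\ w <> coset n g & exists k s, [/\ K n k, S n s & w = coset n (g * k * s)%g]].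
Proof.
split=> [/asboolP[/= nw ngw [a [h [ga wh Sah]]]]|[wg [k [s [Kk Ss wE]]]]]; first last.
  rewrite wE in wg *.
  apply/asboolP; split => //; first by move=> E; exact: wg (esym E).
  exists (g * k)%g, (g * k * s)%g; split; rewrite ?mulKg//.
    by rewrite [(val _).2]/= ltranslateE /= mulKg.
  by rewrite /=; exists 1%g; rewrite ?mulg1//; apply: subgroup1; case: (cosK n).
split=> [/esym//|]; exists (g^-1 * a)%g, (a^-1 * h)%g.
split => //; first by move: ga; rewrite ltranslateE.
have [m [h' wE]] := cosetP w; move: wh nw; rewrite wE => /mem_coset -> /= <-.
by rewrite mulVKg mulVKg.
Qed.

Lemma coset_graph_locally_finite : locally_finite coset_graph.
Proof.
move=> v; have [n [g ->]] := cosetP v.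
have cKS : compact (ltranslate g (mulset (K n) (S n))).
  by apply: compact_ltranslate; apply: compact_mulset => //; case: (cosK n).
apply: sub_finite_set (coset_map_image_finite (cosK n) (coset_coset_map n) cKS).
move=> w /coset_adjP[_ [k [s [Kk Ss ->]]]].
exists (g * (k * s))%g; last by rewrite mulgA.
by exists (k * s)%g => //; exists k => //; exists s.
Qed.

Fact coset_act_subproof g v :
  `[< exists h, ltranslate g (val v).2 = ltranslate h (K (val v).1) >].
Proof.
have [n [h ->]] := cosetP v; apply/asboolP; exists (g * h)%g => /=.
apply/seteqP; split=> [_ [_ [x Kx <-] <-]|_ [x Kx <-]].
  by exists x => //; rewrite mulgA.
by exists (h * x)%g; [exists x|rewrite mulgA].
Qed.

Definition coset_act g v : coset_vertex :=
  exist _ ((val v).1, ltranslate g (val v).2) (coset_act_subproof g v).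

Lemma coset_actE g n h : coset_act g (coset n h) = coset n (g * h)%g.
Proof.
apply: val_inj => /=; congr pair.
apply/seteqP; split=> [_ [_ [x Kx <-] <-]|_ [x Kx <-]].
  by exists x => //; rewrite mulgA.
by exists (h * x)%g; [exists x|rewrite mulgA].
Qed.

Lemma coset_act1 v : coset_act 1%g v = v.
Proof. by have [n [g ->]] := cosetP v; rewrite coset_actE mul1g. Qed.

Lemma coset_actM g h v : coset_act (g * h)%g v = coset_act g (coset_act h v).
Proof. by have [n [x ->]] := cosetP v; rewrite !coset_actE mulgA. Qed.

Lemma coset_act_adj g v w : coset_adj (coset_act g v) (coset_act g w) = coset_adj v w.
Proof.
have H x a b : coset_adj a b -> coset_adj (coset_act x a) (coset_act x b).
  have [n [h ->]] := cosetP a; rewrite coset_actE.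
  move=> /coset_adjP[bh [k [s [Kk Ss E]]]]; apply/coset_adjP; split.
    rewrite -coset_actE => /(congr1 (coset_act (x^-1)%g)).
    by rewrite -!coset_actM mulVg !coset_act1.
  by exists k, s; split => //; rewrite E coset_actE !mulgA.
apply/idP/idP; last exact: H.
by move=> /(H (g^-1)%g); rewrite -!coset_actM mulVg !coset_act1.
Qed.

Lemma coset_graph_proper : @proper_action G coset_graph coset_act.
Proof.
split; first split.
- exact: coset_act1.
- exact: coset_actM.
- exact: coset_act_adj.
- move=> g.
  (* the vertices, here the index set of a product, are given the discrete topology *)
  apply/(@pointwise_cvgP (discrete_topology coset_graph) (discrete_topology coset_graph)).
  move=> v; apply/discrete_cvg.
  have [n [x ->]] := cosetP v.
  have oE : open (rtranslate (ltranslate (g * x)%g (K n)) (x^-1)%g).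
    by apply: open_rtranslate; apply: open_ltranslate; case: (cosK n).
  have Eg : rtranslate (ltranslate (g * x)%g (K n)) (x^-1)%g g.
    exists (g * x)%g; last by rewrite mulgK.
    by exists 1%g; rewrite ?mulg1//; apply: subgroup1; case: (cosK n).
  apply: filterS (open_nbhs_nbhs (conj oE Eg)) => h.
  rewrite rtranslateE ltranslateE /= invgK => Kh.
  by rewrite !coset_actE; apply/esym/coset_coset_map.
- move=> v; have [n [x ->]] := cosetP v.
  have -> : @stabiliser G coset_graph coset_act (coset n x) =
      rtranslate (ltranslate x (K n)) (x^-1)%g.
    apply/seteqP; split=> h; rewrite /stabiliser /= coset_actE rtranslateE ltranslateE /= invgK.
      by move=> /esym/coset_coset_map.
    by move=> /coset_coset_map.
  by apply: compact_rtranslate; apply: compact_ltranslate; case: (cosK n).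
Qed.

Section Lipschitz.
Variable R : realType.

(** [g s g^-1] maps [g K] to [g s K], so a generating set works at every vertex of the
    orbit after conjugation, but not uniformly over the orbit. *)
Lemma coset_orbit_map_lipschitz n g :
  @orbit_map_lipschitz R G coset_graph 1 coset_act
    (rtranslate (ltranslate g (S n)) (g^-1)%g) (coset n g).
Proof.
have [pG _] := coset_graph_proper; apply/(orbit_mapP _ pG) => _ [_ [s Ss <-] <-].
rewrite coset_actE mulgVK.
have [E|nE] := pselect (coset n (g * s)%g = coset n g); [by left|right].
apply/coset_adjP; split => //; exists 1%g, s; split; rewrite ?mulg1//.
by apply: subgroup1; case: (cosK n).
Qed.

Lemma conjugate_compact_symmetric_generating A g :
  compact_symmetric_generating A ->
  compact_symmetric_generating (rtranslate (ltranslate g A) (g^-1)%g).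
Proof.
move=> [cA sA gA]; split.
- by apply: compact_rtranslate; exact: compact_ltranslate.
- move=> _ [_ [a Aa <-] <-]; exists (g * a^-1)%g; last by rewrite !invgM invgK mulgA.
  by exists (a^-1)%g => //; exact: sA.
- move=> H sH AH; pose H' := [set x | H (g * x * g^-1)%g].
  have sH' : is_subgroup H'.
    split; first by rewrite /H'/= mulg1 mulgV; exact: subgroup1.
    move=> x y /= Hx Hy; rewrite /H' /=.
    have -> : (g * (x * y^-1) * g^-1 = (g * x * g^-1) * (g * y * g^-1)^-1)%g.
      by rewrite !invgM invgK !mulgA mulgVK.
    by case: sH => _; exact.
  have H'T : H' = [set: G].
    apply: gA => // a Aa; apply: AH; exists (g * a)%g => //; by exists a.
  apply/seteqP; split => // x _.
  have : H' (g^-1 * x * g)%g by rewrite H'T.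
  by rewrite /H' /= !mulgA mulgV mul1g mulgK.
Qed.

Lemma coset_graph_contingently_lipschitz :
  (forall n, compact_symmetric_generating (S n)) ->
  @contingently_lipschitz_action R G coset_graph 1 coset_act.
Proof.
move=> gS v; have [n [g ->]] := cosetP v.
exists (rtranslate (ltranslate g (S n)) (g^-1)%g); last exact: coset_orbit_map_lipschitz.
exact: conjugate_compact_symmetric_generating.
Qed.

Lemma coset_graph_lipschitz T : compact_symmetric_generating T ->
  (forall n, S n = T) -> @lipschitz_action R G coset_graph 1 coset_act.
Proof.
move=> gT ST; exists T => // v; have [n [g ->]] := cosetP v.
exists (coset n 1%g).
  by exists (g^-1)%g => //; rewrite coset_actE mulVg.
have := coset_orbit_map_lipschitz n 1%g; rewrite ST.
rewrite (_ : rtranslate _ _ = T)//; apply/seteqP; split=> [_ [_ [t Tt <-] <-]|t Tt].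
  by rewrite mul1g invg1 mulg1.
by exists t; [exists t => //; rewrite mul1g|rewrite invg1 mulg1].
Qed.

Variable mu : {measure set (borel G) -> \bar R}.
Hypotheses (lcG : locally_compact_group G) (haar_mu : left_haar_measure mu).

(** With [A] the image of [U] in [G / K n], the preimages of [A] and of its boundary are
    [U K] and a subset of [U K S K \ U K]. *)
Lemma coset_graph_amenable :
  (forall e : R, 0 < e -> exists n U, [/\ compact U, 0 < vol mu U
    & vol mu (mulset (mulset U (K n)) (mulset (S n) (K n)) `\` mulset U (K n))
        <= e * vol mu U]) ->
  amenable_graph R coset_graph.
Proof.
move=> H; apply/amenable_graphP; first exact: coset_graph_locally_finite.
move=> e e0; have [n [U [cU U0 Ue]]] := H e e0.
pose A : set coset_graph := coset n @` U.
have cmap := coset_coset_map n.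
have fA : finite_set A := coset_map_image_finite (cosK n) cmap cU.
have cK : compact (K n) by case: (cosK n).
have fB : finite_set (boundary A).
  exact: boundary_finite coset_graph_locally_finite fA.
have Br : boundary A `<=` range (coset n).
  by move=> w [_ [_ [u Uu <-] /coset_adjP[_ [k [s [_ _ ->]]]]]]; exists (u * k * s)%g.
have Ar : A `<=` range (coset n) by move=> _ [u _ <-]; exists u.
have K0 : 0 < vol mu (K n).
  rewrite lt_neqAle vol_ge0 andbT; apply/eqP => K0.
  have := vol_coset_map_preimage lcG haar_mu (cosK n) cmap fA Ar.
  rewrite -K0 mulr0 (coset_map_preimage_image cmap) => UK0.
  have tU := bounded_borel_compact lcG cU.
  have tUK := bounded_borel_compact lcG (compact_mulset cU cK).
  suff : vol mu U <= vol mu (mulset U (K n)) by rewrite UK0 leNgt U0.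
  apply: vol_le => // u Uu; exists u => //; exists 1%g; rewrite ?mulg1//.
  by apply: subgroup1; case: (cosK n).
exists A; split => //.
  apply: contrapT => nA; move: U0; rewrite (_ : U = set0) ?/vol ?measure0 ?ltxx//.
  by apply/seteqP; split => // u Uu; apply: nA; exists (coset n u); exists u.
rewrite -(ler_pM2r K0) -mulrA.
rewrite -(vol_coset_map_preimage lcG haar_mu (cosK n) cmap fB Br).
rewrite -(vol_coset_map_preimage lcG haar_mu (cosK n) cmap fA Ar).
have tU := bounded_borel_compact lcG cU.
have tUK := bounded_borel_compact lcG (compact_mulset cU cK).
have tUKSK := bounded_borel_compact lcG
  (compact_mulset (compact_mulset cU cK) (compact_mulset (@cS n) cK)).
have tB := bounded_borel_compact lcG (coset_map_preimage_compact (cosK n) cmap fB).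
rewrite (coset_map_preimage_image cmap).
apply: (@le_trans _ _ (e * vol mu U)); last first.
  apply: ler_wpM2l; [exact: ltW|apply: (vol_le lcG haar_mu tU tUK)] => u Uu.
  exists u => //; exists 1%g; rewrite ?mulg1//.
  by apply: subgroup1; case: (cosK n).
apply: le_trans Ue; apply: vol_le => //; first exact: bounded_borelD.
move=> h [nA [_ [u Uu <-]]] /coset_adjP[_ [k [s [Kk Ss /cmap]]]] => Kh.
split; last by rewrite -(coset_map_preimage_image cmap).
exists (u * k)%g; first by exists u => //; exists k.
exists (s * (s^-1 * (u * k)^-1 * h))%g; last by rewrite !mulgA mulgK mulgV mul1g.
exists s => //; exists (s^-1 * (u * k)^-1 * h)%g => //.
rewrite (_ : (s^-1 * (u * k)^-1 * h = (h^-1 * (u * k * s))^-1)%g).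
  by apply: subgroupV => //; case: (cosK n).
by rewrite !invgM invgK.
Qed.

End Lipschitz.
End CosetGraph.

(** * Følner sets give coset graphs *)

Section Forward.
Variables (R : realType) (G : topologicalGroupType).
Variable mu : {measure set (borel G) -> \bar R}.
Hypotheses (lcG : locally_compact_group G) (tdG : totally_disconnected [set: G]).
Hypothesis (haar_mu : left_haar_measure mu).
Implicit Types (A B C K L S T U V N : set G) (g h x y : G).
Local Notation vol := (vol mu).

(** Outer regularity, read off on the relatively compact subsets of [V], because [V]
    itself need not be relatively compact. *)
Lemma compact_outer_approx C (e : R) : compact C -> 0 < e -> exists V,
  [/\ open V, C `<=` V & forall W, bounded_borel W -> W `<=` V -> vol W <= vol C + e].
Proof.
move=> cC e0; have tC := bounded_borel_compact lcG cC; have [mC _] := tC.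
have : (mu C < (vol C + e)%:E)%E by rewrite muE// lte_fin ltrDl.
case: haar_mu => _ _ /(_ _ mC) -> _ _ /ereal_inf_lt[_ [V [oV CV] <-]] muV.
exists V; split => // W tW WV; rewrite -lee_fin -muE//; apply: (le_trans _ (ltW muV)).
by apply: le_measure; rewrite ?inE//; [case: tW|exact: borel_open].
Qed.

Lemma small_thickening U S V : compact U -> compact S -> open V ->
  mulset U S `<=` V -> exists2 K, compact_open_subgroup K &
  mulset (mulset U K) (mulset S K) `<=` V.
Proof.
move=> cU cS oV USV.
have [K1 cosK1 US1] := compact_open_subgroup_basis lcG tdG
  (compact_open_sub_translate (compact_mulset cU cS) oV USV).
have cK1 : compact K1 by case: cosK1.
have US1V : mulset U (mulset S K1) `<=` V.
  move=> _ [u Uu [_ [s Ss [k Kk <-]] <-]]; rewrite mulgA; apply: US1 => //.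
  by exists u => //; exists s.
have [K2 cosK2 US2] := compact_open_subgroup_basis lcG tdG
  (near_mulset cU (compact_mulset cS cK1) oV US1V).
exists (K1 `&` K2); first by apply: compact_open_subgroupI => //; case: lcG.
move=> _ [_ [u Uu [k [_ Kk] <-]] [_ [s Ss [k' [Kk' _] <-]] <-]].
by apply: US2 => //; exists s => //; exists k'.
Qed.

(** By outer regularity [U S] together with [U] lies in an open set of almost the same
    measure, which contains [U K S K] once [K] is small. *)
Lemma folner_thickening U S (e : R) : compact U -> compact S -> 0 < vol U -> 0 < e ->
  vol (mulset U S `\` U) <= e * vol U ->
  exists2 K, compact_open_subgroup K &
    vol (mulset (mulset U K) (mulset S K) `\` mulset U K) <= (e + e) * vol U.
Proof.
move=> cU cS U0 e0 Ue.
have cUS := compact_mulset cU cS.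
have tU := bounded_borel_compact lcG cU; have tUS := bounded_borel_compact lcG cUS.
have eU0 : 0 < e * vol U by rewrite mulr_gt0.
have [V [oV CV Vle]] := compact_outer_approx (compactU cUS cU) eU0.
have [K cosK KV] : exists2 K, compact_open_subgroup K &
    mulset (mulset U K) (mulset S K) `<=` V.
  by apply: small_thickening => // x USx; apply: CV; left.
exists K => //; have [sK cK _] := cosK.
pose X := mulset (mulset U K) (mulset S K).
have tX : bounded_borel X.
  by apply: bounded_borel_compact => //; apply: compact_mulset; exact: compact_mulset.
have UUK : U `<=` mulset U K.
  by move=> u Uu; exists u => //; exists 1%g; rewrite ?mulg1//; exact: subgroup1.
have tUK := bounded_borel_compact lcG (compact_mulset cU cK).
have tW : bounded_borel (X `|` U) by exact: bounded_borelU.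
have /(Vle _ tW) WC : X `|` U `<=` V by move=> x [/KV//|Ux]; apply: CV; right.
apply: (@le_trans _ _ (vol ((X `|` U) `\` U))).
  apply: vol_le => //; [exact: bounded_borelD|exact: bounded_borelD|].
  by move=> x [Xx nUK]; split; [left|move=> /UUK].
have CU : vol (mulset U S `|` U) = vol (mulset U S `\` U) + vol U.
  rewrite (volD lcG haar_mu (bounded_borelU tUS tU) tU); congr (vol _ + vol _).
    by rewrite setDUl setDv setU0.
  by rewrite setIUl setIid; apply/seteqP; split=> [x [[]//|//]|x]; right.
rewrite (vol_setD_sub lcG haar_mu tW tU) => [|x]; last by right.
rewrite lerBlDr (le_trans WC)// CU.
lra.
Qed.

Lemma compact_symmetric_generating_exists : compactly_generated G ->
  exists S : set G, compact_symmetric_generating S.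
Proof.
move=> [T [cT gT]]; exists (T `|` [set (x^-1)%g | x in T]); split.
- by apply: compactU => //; exact: compact_invset.
- by move=> x [Tx|[y Ty <-]]; [right; exists x|left; rewrite invgK].
- by move=> H sH TH; apply: gT => // x Tx; apply: TH; left.
Qed.

Lemma geometrically_amenable_lipschitz_action : compactly_generated G ->
  geometrically_amenable mu ->
  exists (Gamma : simple_graph) (act : G -> Gamma -> Gamma),
    [/\ locally_finite Gamma, amenable_graph R Gamma, proper_action act
      & lipschitz_action (1 : R) act].
Proof.
move=> /compact_symmetric_generating_exists[S gS] /(geometrically_amenableP lcG haar_mu) gaG.
have [K cosK _] := compact_open_subgroup_basis lcG tdG (@filterT _ _ (nbhs_filter (1%g : G))).
have [cS symS _] := gS; have [sK cK _] := cosK.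
exists (@coset_graph G (fun=> K) (fun=> S) (fun=> symS)), (@coset_act G (fun=> K)).
split.
- exact: coset_graph_locally_finite.
- apply: (coset_graph_amenable _ _ _ lcG haar_mu) => //.
  move=> e e0; have cSK := compact_mulset cS cK.
  pose C := K `|` mulset K (mulset S K).
  have cC : compact C by apply: compactU => //; exact: compact_mulset.
  have [U [cU U0 UC]] := gaG C cC e e0; exists 0%N, U; split => //.
  have tU := bounded_borel_compact lcG cU.
  have tUC := bounded_borel_compact lcG (compact_mulset cU cC).
  have tUK := bounded_borel_compact lcG (compact_mulset cU cK).
  have UUK : U `<=` mulset U K.
    by move=> u Uu; exists u => //; exists 1%g; rewrite ?mulg1//; exact: subgroup1.
  have UKC : mulset U K `<=` mulset U C by apply: mulset_sub => // x; left.
  apply: (@le_trans _ _ (vol (mulset U C `\` mulset U K))).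
    apply: vol_le => //; [|exact: bounded_borelD|].
      apply: bounded_borelD => //; apply: bounded_borel_compact => //.
      by apply: compact_mulset => //; exact: compact_mulset.
    move=> x []; rewrite mulsetA => UKSK nUK; split => //.
    by apply: mulset_sub UKSK => // y; right.
  have := vol_le lcG haar_mu tU tUK UUK.
  by rewrite (vol_setD_sub lcG haar_mu tUC tUK UKC); lra.
- exact: coset_graph_proper.
- exact: (coset_graph_lipschitz (fun=> cosK) (fun=> symS) R gS (fun=> erefl)).
Qed.

Lemma folner_star0_contingently_lipschitz_action : folner_star mu = 0%E ->
  exists (Gamma : simple_graph) (act : G -> Gamma -> Gamma),
    [/\ locally_finite Gamma, amenable_graph R Gamma, proper_action act
      & contingently_lipschitz_action (1 : R) act].
Proof.
move=> /(folner_star0P lcG haar_mu) F0.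
have /choice[K_S KSP] (n : nat) : exists KS : set G * set G,
    [/\ compact_open_subgroup KS.1, compact_symmetric_generating KS.2 & exists U,
    [/\ compact U, 0 < vol U &
       vol (mulset (mulset U KS.1) (mulset KS.2 KS.1) `\` mulset U KS.1) <=
         (n.+1%:R^-1 + n.+1%:R^-1) * vol U]].
  have n0 : 0 < n.+1%:R^-1 :> R by rewrite invr_gt0.
  have [S [U [gS cU U0 Ue]]] := F0 _ n0; have cS : compact S by case: gS.
  have [K cosK KU] := folner_thickening cU cS U0 n0 Ue.
  by exists (K, S); split => //; exists U.
pose K n := (K_S n).1; pose S n := (K_S n).2.
have cosK n : compact_open_subgroup (K n) by case: (KSP n).
have gS n : compact_symmetric_generating (S n) by case: (KSP n).
have cS n : compact (S n) by case: (gS n).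
have symS n x : S n x -> S n (x^-1)%g by case: (gS n) => _ + _; exact.
exists (coset_graph K symS), (@coset_act G K).
split.
- exact: coset_graph_locally_finite.
- apply: (coset_graph_amenable _ _ _ lcG haar_mu) => //.
  move=> e e0; have [n ne] : exists n : nat, (e / 2)^-1 < n.+1%:R.
    exists (Num.bound (e / 2)^-1).
    have e20 : 0 <= (e / 2)^-1 by rewrite invr_ge0 divr_ge0// ltW.
    by apply: lt_le_trans (archi_boundP e20) _; rewrite ler_nat.
  have [_ _ [U [cU U0 Ue]]] := KSP n; exists n, U; split => //.
  apply: (le_trans Ue); rewrite ler_pM2r//.
  have : n.+1%:R^-1 < e / 2.
    by rewrite -[e / 2]invrK ltf_pV2 ?posrE ?invr_gt0 ?divr_gt0// ltr0n.
  by move=> /ltW ne2; rewrite (splitr e) lerD.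
- exact: coset_graph_proper.
- exact: coset_graph_contingently_lipschitz.
Qed.

End Forward.

(** * Multiplicities, unimodularity and word balls *)

Section Multiplicity.
Context d (T : measurableType d) (R : realType).
Variable mu : {measure set T -> \bar R}.

(** Integrate the inequality between the sums of indicator functions. *)
Lemma measure_le_multiplicity (s s' : seq (set T)) :
  (forall E, E \in s -> measurable E) -> (forall E, E \in s' -> measurable E) ->
  (forall x, (count (fun E => x \in E) s <= count (fun E => x \in E) s')%N) ->
  (\sum_(E <- s) mu E <= \sum_(E <- s') mu E)%E.
Proof.
have intE (r : seq (set T)) : (forall E, E \in r -> measurable E) ->
    [/\ measurable_fun [set: T] (EFin \o (fun x => (count (fun E => x \in E) r)%:R : R))
      & (\sum_(E <- r) mu E = \int[mu]_x (count (fun E => x \in E) r)%:R%:E)%E].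
  move=> mr; have mn i : measurable (nth set0 r i).
    have [ir|ri] := ltnP i (size r); first by apply: mr; exact: mem_nth.
    by rewrite nth_default.
  pose f i x : \bar R := (\1_(nth set0 r i) x)%:E.
  have mf i : measurable_fun setT (f i).
    by apply/measurable_EFinP; exact: measurable_indic.
  have cE x : ((count (fun E => x \in E) r)%:R%:E =
      \sum_(i <- iota 0 (size r)) f i x)%E.
    rewrite sumEFin -sum1_count natr_sum big_mkcond (big_nth set0) /index_iota subn0.
    by congr EFin; apply: eq_bigr => i _; rewrite indicE; case: ifP.
  split.
    rewrite (_ : _ \o _ = fun x => (\sum_(i <- iota 0 (size r)) f i x)%E).
      exact: emeasurable_sum.
    by apply/funext => x /=; exact: cE.
  under eq_integral do rewrite cE.
  rewrite ge0_integral_sum//; last by move=> i x _; rewrite lee_fin.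
  rewrite (big_nth set0) /index_iota subn0.
  by apply: eq_bigr => i _; rewrite integral_indic ?setIT.
move=> /intE[ms ->] /intE[ms' ->] H; apply: ge0_le_integral => //.
by move=> x _; rewrite lee_fin ler_nat; exact: H.
Qed.

End Multiplicity.

Section Converse.
Variables (R : realType) (G : topologicalGroupType).
Variable mu : {measure set (borel G) -> \bar R}.
Hypotheses (lcG : locally_compact_group G) (tdG : totally_disconnected [set: G]).
Hypothesis (haar_mu : left_haar_measure mu).
Implicit Types (A B C K L S T U V N : set G) (g h x y : G).
Local Notation vol := (vol mu).

Lemma vol_le_multiplicity (s s' : seq (set G)) :
  (forall E, E \in s -> bounded_borel E) -> (forall E, E \in s' -> bounded_borel E) ->
  (forall x, (count (fun E => x \in E) s <= count (fun E => x \in E) s')%N) ->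
  \sum_(E <- s) vol E <= \sum_(E <- s') vol E.
Proof.
move=> ts ts' H; rewrite -lee_fin -!sumEFin.
have E1 (r : seq (set G)) : (forall E, E \in r -> bounded_borel E) ->
    (\sum_(E <- r) (vol E)%:E = \sum_(E <- r) mu E)%E.
  by move=> tr; apply: eq_big_seq => E rE; rewrite (muE lcG haar_mu)//; exact: tr.
rewrite !E1//; apply: (@measure_le_multiplicity _ (borel G) R mu s s') => //.
  by move=> E /ts[].
by move=> E /ts'[].
Qed.

Lemma rtranslateM A g h : rtranslate (rtranslate A g) h = rtranslate A (g * h)%g.
Proof.
apply/seteqP; split=> [_ [_ [a Aa <-] <-]|_ [a Aa <-]].
  by exists a; rewrite ?mulgA.
by exists (a * g)%g; [exists a|rewrite mulgA].
Qed.

Lemma rtrans1 A : rtranslate A 1%g = A.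
Proof.
by apply/seteqP; split=> [_ [a Aa <-]|a Aa]; [rewrite mulg1|exists a; rewrite ?mulg1].
Qed.

Lemma rtranslate_setD A B g : rtranslate (A `\` B) g = rtranslate A g `\` rtranslate B g.
Proof. by rewrite !rtranslateE. Qed.

Definition compact_open A := compact A /\ open A.

Lemma compact_open_rtranslate A g : compact_open A -> compact_open (rtranslate A g).
Proof. by move=> [cA oA]; split; [exact: compact_rtranslate|exact: open_rtranslate]. Qed.

Lemma compact_openD A B : compact_open A -> compact_open B -> compact_open (A `\` B).
Proof.
move=> [cA oA] [cB oB]; case: lcG => hG _; split.
  by rewrite setDE; apply: compact_closedI => //; exact: open_closedC.
by rewrite setDE; apply: openI => //; apply: closed_openC; exact: compact_closed.
Qed.

Lemma compact_open_bounded_borel A : compact_open A -> bounded_borel A.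
Proof. by move=> [cA _]; exact: bounded_borel_compact. Qed.

Lemma compact_open_subgroup_conj L g : compact_open_subgroup L ->
  compact_open_subgroup (ltranslate (g^-1)%g (rtranslate L g)).
Proof.
move=> [sL cL oL]; split; last 2 first.
- by apply: compact_ltranslate; exact: compact_rtranslate.
- by apply: open_ltranslate; exact: open_rtranslate.
have E x : ltranslate (g^-1)%g (rtranslate L g) x <-> L (g * x * g^-1)%g.
  by rewrite ltranslateE rtranslateE /= invgK.
split; first by apply/E; rewrite mulg1 mulgV; exact: subgroup1.
move=> x y /E Lx /E Ly; apply/E.
have -> : (g * (x * y^-1) * g^-1 = (g * x * g^-1) * (g * y * g^-1)^-1)%g.
  by rewrite !invgM invgK !mulgA mulgVK.
by case: sL => _; exact.
Qed.

(** If [C] is a union of [n] left cosets of [L], then [C g] is a union of [n] left cosets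
    of [g^-1 L g]. The number [n] is the same for all [g]. *)
Lemma vol_rtranslate_cosets L C : compact_open_subgroup L -> compact C ->
  mulset C L `<=` C -> exists n : nat, forall g,
  vol (rtranslate C g) = n%:R * vol (ltranslate (g^-1)%g (rtranslate L g)).
Proof.
move=> cosL cC CL; have [sL cL oL] := cosL.
have phiL := coset_map_ltranslate sL.
have fB := coset_map_image_finite cosL phiL cC.
exists (card_set [set ltranslate x L | x in C]) => g.
have psiL : coset_map (fun h => ltranslate (h * g^-1)%g L) (ltranslate (g^-1)%g (rtranslate L g)).
  move=> h k; rewrite (phiL (h * g^-1)%g (k * g^-1)%g) ltranslateE rtranslateE /= invgK invgM invgK.
  by rewrite !mulgA.
rewrite -(vol_coset_map_preimage lcG haar_mu (compact_open_subgroup_conj g cosL) psiL fB).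
  congr vol; rewrite rtranslateE; apply/seteqP; split=> [x Cx /=|x /= [c Cc /phiL Lcx]].
    by exists (x * g^-1)%g.
  by apply: CL; exists c => //; exists (c^-1 * (x * g^-1))%g => //; rewrite mulVKg.
by move=> _ [c Cc <-]; exists (c * g)%g; rewrite ?mulgK.
Qed.

(** The modular function, without uniqueness of Haar measure: two compact open sets are
    unions of left cosets of one small subgroup [L], so right translation by [g] multiplies
    both volumes by [vol (g^-1 L g) / vol L]. *)
Lemma vol_rtranslate_proportional C D g : compact_open C -> compact_open D ->
  vol (rtranslate C g) * vol D = vol C * vol (rtranslate D g).
Proof.
move=> [cC oC] [cD oD].
have [L1 cos1 CL1] := compact_open_right_invariant lcG tdG cC oC.
have [L2 cos2 CL2] := compact_open_right_invariant lcG tdG cD oD.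
have cosL : compact_open_subgroup (L1 `&` L2).
  by apply: compact_open_subgroupI => //; case: lcG.
have [|n Cn] := vol_rtranslate_cosets cosL cC.
  by apply: subset_trans CL1; apply: mulset_sub => // x [].
have [|m Dm] := vol_rtranslate_cosets cosL cD.
  by apply: subset_trans CL2; apply: mulset_sub => // x [].
have := Cn 1%g; have := Dm 1%g; rewrite !rtrans1 => -> ->; rewrite Cn Dm.
ring.
Qed.

(** Right invariance, tested only on the sets for which it is used. *)
Definition unimodular := forall C g, compact_open C -> vol (rtranslate C g) = vol C.

Definition folner_generating S := compact_symmetric_generating S /\
  forall d : R, 0 < d -> exists U, [/\ compact_open U, U !=set0
    & vol (mulset U S `\` U) <= d * vol U].

Lemma vol_compact_open_gt0 U : compact_open U -> U !=set0 -> 0 < vol U.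
Proof. by move=> cU; apply: vol_gt0 => //; [exact: compact_open_bounded_borel|case: cU]. Qed.

Lemma vol_rtranslateD_le U S s : compact_open U -> compact S -> S s ->
  vol (rtranslate U s `\` U) <= vol (mulset U S `\` U).
Proof.
move=> cU cS Ss; have tU := compact_open_bounded_borel cU.
apply: vol_le => //.
- by apply: bounded_borelD => //; apply: compact_open_bounded_borel; exact: compact_open_rtranslate.
- apply: bounded_borelD => //; apply: bounded_borel_compact => //.
  by apply: compact_mulset => //; case: cU.
- by move=> _ [[u Uu <-] nU]; split => //; exists u => //; exists s.
Qed.

(** If [mu (U S \ U) <= d * mu U], translation by [s] in [S] multiplies volumes by at most
    [1 + d]. Letting [d] tend to 0 and using [s^-1] as well, every [s] in [S] preserves
    volumes; the elements that do so form a subgroup. *)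
Lemma folner_generating_unimodular S : folner_generating S -> unimodular.
Proof.
move=> [[cS symS gS] F].
have le C s : S s -> compact_open C -> vol (rtranslate C s) <= vol C.
  move=> Ss cC; apply/ler_addgt0Pr => e e0.
  have VC0 : 0 <= vol C by exact: vol_ge0.
  (* adding 1 avoids a case distinction when [C] is empty *)
  have d0 : 0 < e / (vol C + 1) by rewrite divr_gt0// ltr_wpDl.
  have [U [cU U0 Ud]] := F _ d0; have VU0 := vol_compact_open_gt0 cU U0.
  have tU := compact_open_bounded_borel cU; have cUs := compact_open_rtranslate s cU.
  have tUs := compact_open_bounded_borel cUs.
  have Us : vol (rtranslate U s) <= (1 + e / (vol C + 1)) * vol U.
    rewrite (volD lcG haar_mu tUs tU) mulrDl mul1r addrC; apply: lerD.
      by apply: (vol_le lcG haar_mu (bounded_borelI tUs tU) tU) => x [].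
    exact: le_trans (vol_rtranslateD_le cU cS Ss) Ud.
  rewrite -(ler_pM2r VU0) vol_rtranslate_proportional//.
  apply: (le_trans (ler_wpM2l VC0 Us)).
  rewrite mulrA ler_pM2r// mulrDr mulr1 lerD2l mulrCA.
  have C1 : 0 < vol C + 1 by rewrite ltr_wpDl.
  by apply: ler_piMr; [exact: ltW|rewrite ler_pdivrMr// mul1r lerDl].
pose H := [set g | forall C, compact_open C -> vol (rtranslate C g) = vol C].
have sH : is_subgroup H.
  split; first by move=> C _; rewrite rtrans1.
  move=> x y Hx Hy C cC; rewrite -rtranslateM -(Hx _ cC).
  rewrite -(Hy (rtranslate (rtranslate C x) (y^-1)%g)).
    by rewrite rtranslateM mulVg rtrans1.
  by do 2 apply: compact_open_rtranslate.
have HT : H = [set: G].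
  apply: gS => // s Ss C cC; apply/eqP; rewrite eq_le le//=.
  have := le (rtranslate C s) _ (symS _ Ss) (compact_open_rtranslate s cC).
  by rewrite rtranslateM mulgV rtrans1.
by move=> C g cC; have : H g by [rewrite HT]; exact.
Qed.

(** [U g h \ U] is covered by [(U g \ U) h] and [U h \ U], and right translation by [h]
    preserves the volume of the first. *)
Lemma displacementM U g h : unimodular -> compact_open U ->
  vol (rtranslate U (g * h)%g `\` U) <= vol (rtranslate U g `\` U) + vol (rtranslate U h `\` U).
Proof.
move=> uni cU; have cUg := compact_open_rtranslate g cU.
have cUh := compact_open_rtranslate h cU.
have cD := compact_openD cUg cU.
rewrite -(uni (rtranslate U g `\` U) h cD).
have t1 := compact_open_bounded_borel (compact_open_rtranslate h cD).
have t2 := compact_open_bounded_borel (compact_openD cUh cU).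
apply: le_trans (vol_setU_le lcG haar_mu t1 t2).
apply: vol_le => //.
- by apply: compact_open_bounded_borel; apply: compact_openD => //; exact: compact_open_rtranslate.
- exact: bounded_borelU.
rewrite rtranslate_setD rtranslateM => x [Ux nUx].
by have [Uhx|nUhx] := pselect (rtranslate U h x); [right|left].
Qed.

Fixpoint word_ball S n : set G :=
  if n is m.+1 then mulset (word_ball S m) (1%g |` S) else [set 1%g].

Lemma displacement_word_ball S U (d : R) n g : unimodular -> compact_open U ->
  0 <= d -> compact S -> vol (mulset U S `\` U) <= d -> word_ball S n g ->
  vol (rtranslate U g `\` U) <= n%:R * d.
Proof.
move=> uni cU d0 cS Ud; elim: n g => [|n IH] g /=.
  by move=> ->; rewrite rtrans1 setDv /vol measure0 mul0r.
move=> [h /IH hn [s Ss <-]]; apply: (le_trans (displacementM _ _ uni cU)).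
rewrite -natr1 mulrDl mul1r lerD//.
case: Ss => [->|Ss]; first by rewrite rtrans1 setDv /vol measure0.
exact: le_trans (vol_rtranslateD_le cU cS Ss) Ud.
Qed.

Section WordBall.
Variables (S : set G) (gS : compact_symmetric_generating S).
Local Notation ball := (word_ball S).

Lemma word_ball_compact n : compact (ball n).
Proof.
have [cS _ _] := gS; elim: n => [|n IH] /=; first exact: compact_set1.
by apply: compact_mulset => //; apply: compactU => //; exact: compact_set1.
Qed.

Lemma word_ballD n m g h : ball n g -> ball m h -> ball (n + m) (g * h)%g.
Proof.
move=> ng; elim: m h => [|m IH] h /=; first by move=> ->; rewrite mulg1 addn0.
by move=> [k /IH mk [s Ss <-]]; rewrite addnS mulgA; exists (g * k)%g => //; exists s.
Qed.

Lemma word_ball_le n m : (n <= m)%N -> ball n `<=` ball m.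
Proof.
move=> /subnKC <- g ng; rewrite -[g]mulg1; apply: word_ballD => //.
elim: (m - n)%N => //= k IH; exists 1%g => //; exists 1%g; rewrite ?mulg1//.
by left.
Qed.

Lemma word_ballV n g : ball n g -> ball n (g^-1)%g.
Proof.
have [_ symS _] := gS; elim: n g => [|n IH] g /=; first by move=> ->; rewrite invg1.
move=> [h /IH nh [s Ss <-]]; rewrite invgM; apply: (@word_ballD 1 n) => //.
exists 1%g => //; exists (s^-1)%g; rewrite ?mul1g//.
by case: Ss => [->|/symS]; [left; rewrite invg1|right].
Qed.

Lemma word_ball_cover g : exists n, ball n g.
Proof.
have [_ _ genS] := gS; suff HT : [set x | exists n, ball n x] = [set: G].
  by have : [set x | exists n, ball n x] g by rewrite HT.
apply: genS => [|s Ss]; last first.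
  by exists 1%N, 1%g => //; exists s; rewrite ?mul1g//; right.
split; first by exists 0%N.
move=> x y [n nx] [m my]; exists (n + m)%N; apply: word_ballD => //.
exact: word_ballV.
Qed.

(** The balls are countably many and cover [G], which has non-zero measure. *)
Lemma word_ball_vol_gt0 : exists n, 0 < vol (ball n).
Proof.
apply: contrapT => H; have V0 n : mu (ball n) = 0%E.
  rewrite (muE lcG haar_mu (bounded_borel_compact lcG (@word_ball_compact n))); congr EFin.
  by apply/eqP; rewrite eq_le vol_ge0 andbT leNgt; apply/negP => ?; apply: H; exists n.
case: haar_mu => _ _ _ _ /negP; apply; apply/eqP; apply: measure_negligible => //.
rewrite (_ : [set: G] = \bigcup_n ball n).
  apply: negligible_bigcup => n; exists (ball n); split => //.
  by apply: (borel_compact lcG); exact: word_ball_compact.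
by apply/seteqP; split => // g _; have [n ng] := word_ball_cover g; exists n.
Qed.

(** Steinhaus: if [A] has positive volume and [V] is an open set containing it of
    volume less than twice that of [A], then [w A] stays in [V] for [w] near 1, so it meets
    [A], and [w] is in [A A^-1]. The factor 3/2 below leaves the needed room. *)
Lemma word_ball_nbhs : exists n, nbhs (1%g : G) (ball n).
Proof.
have [n V0] := word_ball_vol_gt0; exists (n + n)%N.
pose A := ball n; have cA : compact A := @word_ball_compact n.
have tA := bounded_borel_compact lcG cA.
have V20 : 0 < vol A / 2 by rewrite divr_gt0.
have [V [oV AV Vle]] := compact_outer_approx lcG haar_mu cA V20.
have AV1 : mulset [set 1%g] A `<=` V.
  by move=> _ [_ -> [a Aa <-]]; rewrite mul1g; exact: AV.
have := near_mulset (@compact_set1 _ (1%g : G)) cA oV AV1.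
apply: filterS => w /(_ 1%g _ erefl) wA.
have wAV : ltranslate w A `<=` V by move=> _ [a Aa <-]; have := wA a Aa; rewrite mul1g.
have twA := bounded_borel_compact lcG (@compact_ltranslate _ w _ cA).
have [b [[a Aa wab] Ab]] : ltranslate w A `&` A !=set0.
  apply/set0P/eqP => wA0.
  have : vol (ltranslate w A `|` A) <= vol A + vol A / 2.
    by apply: Vle; [exact: bounded_borelU|move=> x [/wAV|/AV]].
  rewrite (volD lcG haar_mu (bounded_borelU twA tA) tA) setDUl setDv setU0.
  rewrite setIUl wA0 set0U setIid (_ : ltranslate w A `\` A = ltranslate w A).
    by rewrite (vol_ltranslate haar_mu); [lra|case: tA].
  by apply/setDidPl.
rewrite (_ : w = b * a^-1)%g; first by apply: word_ballD => //; exact: word_ballV.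
by rewrite -wab mulgK.
Qed.

(** A ball contains a neighbourhood of 1, so the balls are eventually neighbourhoods of
    any given point, and compactness makes this uniform. *)
Lemma compact_sub_word_ball A : compact A -> exists n, A `<=` ball n.
Proof.
move=> /compact_near_coveringP cA; have [m nm] := word_ball_nbhs.
suff [n _ H] : \forall n \near \oo, A `<=` (fun x => ball n x).
  by exists n; apply: H => /=.
apply: cA => x _; have [k kx] := word_ball_cover x.
exists ([set y | ball (k + m) y], [set n | (k + m <= n)%N]).
  split=> /=; last by exists (k + m)%N.
  apply: nbhs_translate; apply: filterS nm => y my; exact: word_ballD.
by move=> [y n] /= [yk kn]; exact: word_ball_le yk.
Qed.

End WordBall.

End Converse.

(** * Smoothing Følner sets by level sets *)

Section Counting.
Local Open Scope nat_scope.

Lemma count_split (T : Type) (a b : pred T) s :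
  count a s = count (fun x => a x && b x) s + count (fun x => a x && ~~ b x) s.
Proof. by elim: s => //= x s ->; case: (a x); case: (b x) => /=; lia. Qed.

Lemma count_ltn_iota n q : n <= q -> count (fun j => j < n) (iota 0 q) = n.
Proof.
move=> /subnKC <-; rewrite iotaD count_cat add0n.
rewrite (@eq_in_count _ _ predT) => [|j]; last by rewrite mem_iota add0n.
rewrite count_predT size_iota (@eq_in_count _ _ pred0 (iota n _)) ?count_pred0 ?addn0//.
by move=> j; rewrite mem_iota => /andP[nj _] /=; rewrite ltnNge nj.
Qed.

Lemma count_itv_iota m n q : m <= q -> n <= q ->
  count (fun j => (j < n) && ~~ (j < m)) (iota 0 q) = n - m.
Proof.
move=> mq nq; have := count_split (fun j => j < n) (fun j => j < m) (iota 0 q).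
rewrite (count_ltn_iota nq) (@eq_count _ (fun j => (j < n) && (j < m)) (fun j => j < minn n m)).
  by rewrite count_ltn_iota; lia.
by move=> j /=; rewrite leq_min.
Qed.

Lemma count_sub_le (T : Type) (a b : pred T) s :
  count a s - count b s <= count (fun x => a x && ~~ b x) s.
Proof.
rewrite (count_split a b); suff : count (fun x => a x && b x) s <= count b s by lia.
by apply: sub_count => x /andP[].
Qed.

End Counting.

Section Smoothing.
Variables (R : realType) (G : topologicalGroupType).
Variable mu : {measure set (borel G) -> \bar R}.
Hypotheses (lcG : locally_compact_group G) (tdG : totally_disconnected [set: G]).
Hypothesis (haar_mu : left_haar_measure mu).
Implicit Types (A B C K L S T U V N : set G) (g h x y : G).
Local Notation vol := (vol mu).

Lemma compact_finite_transversal L A : compact_open_subgroup L -> compact A ->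
  exists ts : seq G, forall a, A a -> exists2 t, t \in ts & L (t^-1 * a)%g.
Proof.
move=> cosL cA; have [sL _ _] := cosL; have phiL := coset_map_ltranslate sL.
have fB := coset_map_image_finite cosL phiL cA.
pose r (c : set G) : G := xget 1%g [set h | ltranslate h L = c].
exists [seq r c | c <- fset_set [set ltranslate x L | x in A]] => a Aa.
exists (r (ltranslate a L)).
  by apply: map_f; rewrite in_fset_set// inE; exists a.
apply/phiL; rewrite /r; case: xgetP => [h _ //|] /(_ a) /=.
by move=> /(_ erefl).
Qed.

Section LevelSets.
Variables (K U : set G) (ts : seq G) (c : R).
Hypotheses (uni : unimodular mu) (cosK : compact_open_subgroup K).
Hypotheses (cU : compact_open U) (U0 : U !=set0).
Hypothesis (Uts : forall k t, K k -> t \in ts ->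
  vol (rtranslate U (k^-1 * t^-1 * k)%g `\` U) <= c * vol U).

(** Write [K] as a union of cosets [r L], where [L] is so small that [U L = U], and let
    [N x] count the cosets [r L] with [x r] in [U]. As [N x * vol L] is the volume of
    [x K] intersected with [U], the function [N] is right [K]-invariant. Its level sets
    [V j] satisfy two relations between multiplicities: [x] lies in [N x] of the sets [V j]
    as well as in [N x] of the translates [U r^-1], and it lies in [N (x t) - N x] of the
    sets [V j t^-1 \ V j], which is at most the number of [r] with [x] in
    [U (t r)^-1 \ U r^-1]. The latter sets are translates of [U r^-1 t^-1 r \ U], hence
    small. Summing volumes over [j], some level set must be almost invariant. The bound
    does not involve the index of [L] in [K], over which there is no control. *)
Lemma folner_level_set : exists V, [/\ compact_open V, 0 < vol V, mulset V K `<=` V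
  & \sum_(t <- ts) vol (rtranslate V (t^-1)%g `\` V) <= (size ts)%:R * c * vol V].
Proof.
have [sK cK oK] := cosK; have [ccU oU] := cU.
have tU := compact_open_bounded_borel lcG cU.
have VU0 := vol_compact_open_gt0 lcG tdG haar_mu cU U0.
have [L0 cosL0 UL0] := compact_open_right_invariant lcG tdG ccU oU.
pose L := K `&` L0.
have cosL : compact_open_subgroup L by apply: compact_open_subgroupI => //; case: lcG.
have UL x l : U x -> L l -> U (x * l)%g.
  by move=> Ux [_ Ll]; apply: UL0; exists x => //; exists l.
have [sL cL oL] := cosL; have phiL := coset_map_ltranslate sL.
have VL0 : 0 < vol L.
  apply: (vol_gt0 lcG tdG haar_mu (bounded_borel_compact lcG cL) oL).
  by exists 1%g; exact: subgroup1.
pose phi x := ltranslate x L.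
have fB : finite_set (phi @` K) := coset_map_image_finite cosL phiL cK.
pose F : seq (set G) := fset_set (phi @` K).
(* representatives of the cosets of [L] in [K] *)
pose r (e : set G) : G := xget 1%g [set h | K h /\ phi h = e].
have rP e : e \in F -> K (r e) /\ phi (r e) = e.
  rewrite in_fset_set// inE => -[k Kk ke]; rewrite /r; case: xgetP => [h _ //|].
  by move=> /(_ k)/=; case.
pose N x := count (fun e => `[< U (x * r e)%g >]) F.
pose q := size F.
have Nq x : (N x <= q)%N by exact: count_size.
have volN x : vol (ltranslate x K `&` U) = (N x)%:R * vol L.
  have psiL : coset_map (fun h => phi (x^-1 * h)%g) L.
    move=> h k; rewrite (phiL (x^-1 * h)%g (x^-1 * k)%g) invgM invgK.
    by rewrite mulgA mulgK.
  pose D : set (set G) := [set e | (phi @` K) e /\ U (x * r e)%g].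
  have fD : finite_set D by apply: sub_finite_set fB => e [].
  have Dr : D `<=` range (fun h => phi (x^-1 * h)%g).
    by move=> e [[k Kk <-] _]; exists (x * k)%g; rewrite ?mulKg.
  have -> : N x = card_set D.
    rewrite /N -size_filter; apply: perm_size; apply: uniq_perm; [|exact: fset_uniq|].
      by apply: filter_uniq; exact: fset_uniq.
    move=> e; rewrite mem_filter !in_fset_set// /D andbC.
    by apply/andP/idP; rewrite !inE => -[].
  rewrite -(vol_coset_map_preimage lcG haar_mu cosL psiL fD Dr); congr vol.
  have Ur y : K y -> U (x * r (phi y))%g <-> U (x * y)%g.
    move=> Ky; have [|Kr /phiL rL] := rP (phi y).
      by rewrite in_fset_set// inE; exists y.
    split=> [Ux|Ux].
      by have := UL _ _ Ux rL; rewrite -mulgA mulVKg.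
    by have := UL _ _ Ux (subgroupV sL rL); rewrite invgM invgK -mulgA mulVKg.
  apply/seteqP; split=> [y []|y [[k Kk /phiL kL] /=]].
    rewrite ltranslateE /= => Ky Uy; split; first by exists (x^-1 * y)%g.
    by apply/(Ur _ Ky); rewrite mulVKg.
  have Ky : K (x^-1 * y)%g.
    by have := subgroupM sK Kk kL.1; rewrite mulVKg.
  by move=> /(Ur _ Ky); rewrite mulVKg ltranslateE.
have NK x k : K k -> N (x * k)%g = N x.
  move=> Kk; apply/eqP; rewrite -(eqr_nat R); apply/eqP.
  apply: (mulIf (lt0r_neq0 VL0)); rewrite -!volN.
  congr (vol (_ `&` _)); apply/(subgroup_ltranslate_eq sK).
  by rewrite invgM -mulgA mulVg mulg1; exact: subgroupV.
pose V j := [set x | (j < N x)%N].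
have VK j : mulset (V j) K `<=` V j by move=> _ [x Vx [k Kk <-]]; rewrite /V/= NK.
have open_inv A : (forall x k, A x -> K k -> A (x * k)%g) -> open A.
  move=> AK; rewrite (_ : A = mulset A K); first exact: open_mulset.
  apply/seteqP; split=> [x Ax|_ [x Ax [k Kk <-]]]; last exact: AK.
  by exists x => //; exists 1%g; rewrite ?mulg1//; exact: subgroup1.
have cV j : compact_open (V j).
  split; last by apply: open_inv => x k Vx Kk; apply: VK; exists x => //; exists k.
  apply: (subclosed_compact _ (compact_mulset ccU cK)).
    rewrite -[V j]setCK; apply: open_closedC; apply: open_inv => x k /=.
    by rewrite /V /= => nV Kk; rewrite NK.
  move=> x; rewrite /V /= => jN.
  have : has (fun e => `[< U (x * r e)%g >]) F by rewrite has_count (leq_ltn_trans _ jN).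
  move=> /hasP[e /rP[Kr _] /asboolP Ux].
  by exists (x * r e)%g => //; exists (r e)^-1%g; [exact: subgroupV|rewrite mulgK].
have tV j := compact_open_bounded_borel lcG (cV j).
pose A e := rtranslate U (r e)^-1%g.
have AE e x : (x \in A e) = `[< U (x * r e)%g >].
  by apply/idP/asboolP; rewrite inE /A rtranslateE /= invgK.
have cA e : compact_open (A e) by exact: compact_open_rtranslate.
(* each translate of [U] has the volume of [U] by unimodularity *)
have sumV : q%:R * vol U <= \sum_(j <- iota 0 q) vol (V j).
  have -> : q%:R * vol U = \sum_(E <- [seq A e | e <- F]) vol E.
    rewrite big_map (eq_bigr (fun=> vol U)) => [|e _]; last exact: uni.
    by rewrite big_const_seq count_predT iter_addr_0 mulr_natl.
  rewrite -(big_map V predT vol); apply: (vol_le_multiplicity lcG haar_mu).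
  - by move=> _ /mapP[e _ ->]; exact: compact_open_bounded_borel.
  - by move=> _ /mapP[j _ ->].
  move=> x; rewrite !count_map (@eq_count _ _ (fun e => `[< U (x * r e)%g >])); last first.
    by move=> e /=; rewrite AE.
  rewrite (@eq_count _ (preim V _) (fun j => (j < N x)%N)) ?count_ltn_iota//.
  by move=> j /=; apply/idP/idP; rewrite inE.
have sumD t : t \in ts ->
    \sum_(j <- iota 0 q) vol (rtranslate (V j) (t^-1)%g `\` V j) <= q%:R * (c * vol U).
  move=> tts; pose A' e := rtranslate U (t * r e)^-1%g `\` A e.
  apply: (@le_trans _ _ (\sum_(E <- [seq A' e | e <- F]) vol E)); last first.
    rewrite big_map; apply: (@le_trans _ _ (\sum_(e <- F) c * vol U)).
      rewrite big_seq [leRHS]big_seq; apply: ler_sum => e /rP[Kr _].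
      apply: le_trans (Uts Kr tts).
      rewrite -[leRHS](uni (r e)^-1%g); last first.
        by apply: compact_openD => //; exact: compact_open_rtranslate.
      by rewrite rtranslate_setD rtranslateM mulgK -invgM.
    by rewrite big_const_seq count_predT iter_addr_0 mulr_natl.
  rewrite -(big_map (fun j => rtranslate (V j) (t^-1)%g `\` V j) predT vol).
  apply: (vol_le_multiplicity lcG haar_mu).
  - move=> _ /mapP[j _ ->]; apply: compact_open_bounded_borel => //; apply: compact_openD => //.
    exact: compact_open_rtranslate.
  - move=> _ /mapP[e _ ->]; apply: compact_open_bounded_borel => //; apply: compact_openD => //.
    exact: compact_open_rtranslate.
  move=> x; rewrite !count_map.
  rewrite (@eq_count _ _ (fun j => (j < N (x * t)%g)%N && ~~ (j < N x)%N)); last first.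
    move=> j /=; apply/idP/andP.
      by rewrite inE rtranslateE /V /= invgK => -[? /negP].
    by rewrite inE rtranslateE /V /= invgK => -[? /negP].
  rewrite count_itv_iota//.
  rewrite (@eq_count _ (preim A' _)
    (fun e => `[< U (x * t * r e)%g >] && ~~ `[< U (x * r e)%g >])).
    exact: count_sub_le.
  move=> e /=; rewrite -(AE e x); apply/idP/andP.
    rewrite inE /A' rtranslateE /= invgK mulgA => -[? nA].
    by split; [exact/asboolP|rewrite notin_setE].
  move=> [/asboolP Ut]; rewrite notin_setE => nA.
  by rewrite inE /A' rtranslateE /= invgK mulgA.
have q0 : 0 < q%:R * vol U.
  rewrite mulr_gt0// ltr0n /q; apply: card_set_gt0 => //.
  by exists (phi 1%g); exists 1%g => //; exact: subgroup1.
have [||||j _ [Vj0 Vj]] := @exists_le_of_sum_le R _ (iota 0 q)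
  (fun j => \sum_(t <- ts) vol (rtranslate (V j) (t^-1)%g `\` V j)) (fun j => vol (V j))
  ((size ts)%:R * c).
- by move=> j _; apply: sumr_ge0 => t _; exact: vol_ge0.
- by move=> j _; exact: vol_ge0.
- rewrite exchange_big/=.
  have [ts0|[t0 t0ts]] : ts = [::] \/ exists t, t \in ts.
    by case: (ts) => [|t s]; [left|right; exists t; exact: mem_head].
    by rewrite ts0 big_nil/= mul0r mul0r.
  have c0 : 0 <= c.
    rewrite -(pmulr_lge0 _ VU0); apply: le_trans (Uts (subgroup1 sK) t0ts).
    exact: vol_ge0.
  apply: (@le_trans _ _ (\sum_(t <- ts) q%:R * (c * vol U))).
    by rewrite big_seq [leRHS]big_seq; exact: ler_sum.
  rewrite big_const_seq count_predT iter_addr_0 -[leLHS]mulr_natl -[leRHS]mulrA.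
  by apply: ler_wpM2l => //; rewrite mulrCA; exact: ler_wpM2l.
- exact: lt_le_trans sumV.
by exists (V j); split.
Qed.

End LevelSets.

(** The elements [t] are chosen with [Q] inside the union of the [K t^-1], so that [V Q] is
    covered by the translates [V t^-1] of a right [K]-invariant set [V]. All conjugates
    of the [t^-1] by [K] lie in one word ball, whose radius is fixed before [d]. *)
Lemma folner_generating_geometrically_amenable S :
  folner_generating mu S -> geometrically_amenable mu.
Proof.
move=> FS; have uni := folner_generating_unimodular lcG tdG haar_mu FS.
have [gS F] := FS; have [cS _ _] := gS.
apply/(geometrically_amenableP lcG haar_mu) => Q cQ e e0.
have [K cosK _] := compact_open_subgroup_basis lcG tdG (@filterT _ _ (nbhs_filter (1%g : G))).
have [sK cK oK] := cosK.
have [ts tsP] := compact_finite_transversal cosK (compact_invset cQ).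
pose W := mulset (mulset K [set (t^-1)%g | t in [set` ts]]) K.
have cW : compact W.
  apply: compact_mulset => //; apply: compact_mulset => //; apply: compact_invset.
  exact/finite_compact/finite_seq.
have [n Wn] := compact_sub_word_ball lcG haar_mu gS cW.
pose d := e / ((size ts)%:R * n%:R + 1).
have d1 : 0 < (size ts)%:R * n%:R + 1 :> R by rewrite ltr_wpDl// mulr_ge0.
have d0 : 0 < d by rewrite divr_gt0.
have [U [cU U0 Ud]] := F d d0.
have VU0 := vol_compact_open_gt0 lcG tdG haar_mu cU U0.
have [|V [cV V0 VK Vts]] := @folner_level_set K U ts (n%:R * d) uni cosK cU U0.
  move=> k t Kk tts; rewrite -mulrA.
  apply: (displacement_word_ball lcG haar_mu uni cU _ cS Ud).
    by rewrite mulr_ge0// ltW.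
  apply: Wn; exists (k^-1 * t^-1)%g; last by exists k.
  exists (k^-1)%g; first exact: subgroupV.
  by exists (t^-1)%g => //; exists t.
have [ccV _] := cV; have tV := compact_open_bounded_borel lcG cV.
exists V; split => //.
have tD t : bounded_borel (rtranslate V (t^-1)%g `\` V).
  apply: compact_open_bounded_borel => //; apply: compact_openD => //.
  exact: compact_open_rtranslate.
have VQ : vol (mulset V Q) <= vol V + \sum_(t <- ts) vol (rtranslate V (t^-1)%g `\` V).
  have := @vol_le_multiplicity R G mu lcG haar_mu [:: mulset V Q]
    (V :: [seq rtranslate V (t^-1)%g `\` V | t <- ts]).
  rewrite big_seq1 big_cons big_map; apply.
  - by move=> E; rewrite inE => /eqP ->; apply: bounded_borel_compact => //; exact: compact_mulset.
  - by move=> E; rewrite inE => /predU1P[->//|/mapP[t _ ->]].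
  move=> x /=; rewrite addn0.
  case: (boolP (x \in mulset V Q)) => //; rewrite inE => -[v Vv [s Qs vsx]].
  have [Vx|nVx] := boolP (x \in V); first by rewrite leq_addr.
  rewrite add0n -has_count has_map; have [|t tts Kt] := tsP (s^-1)%g; first by exists s.
  apply/hasP; exists t => //=; rewrite inE; split; last by move: nVx; rewrite notin_setE.
  rewrite rtranslateE /= invgK; apply: VK; exists v => //; exists (s * t)%g.
    by have := subgroupV sK Kt; rewrite invgM !invgK.
  by rewrite mulgA vsx.
apply: (le_trans VQ); rewrite mulrDl mul1r lerD2l (le_trans Vts)//.
rewrite ler_pM2r// mulrA /d mulrCA ler_piMr ?ltW//.
by rewrite ltr_pdivrMr// mul1r ltrDl.
Qed.

Lemma lipschitz_geometrically_amenable :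
  (exists (Gamma : simple_graph) (act : G -> Gamma -> Gamma),
     [/\ locally_finite Gamma, amenable_graph R Gamma, proper_action act
       & lipschitz_action (1 : R) act]) ->
  geometrically_amenable mu.
Proof.
move=> [Gamma [act [lfG aG pG [S gS lipG]]]].
apply: (@folner_generating_geometrically_amenable S); split => // d d0.
have [y Hy] := amenable_action_folner lcG haar_mu lfG aG pG d0.
have [x yx Sx] := lipG y; have cS : compact S by case: gS.
have [U [cU oU U0 Ud]] := Hy x S cS yx Sx.
by exists U.
Qed.

End Smoothing.

(** * The two characterisations *)

Theorem theorem1p9 (R : realType) (G : topologicalGroupType)
    (mu : {measure set (borel G) -> \bar R})
    (lcG : locally_compact_group G)
    (tdG : totally_disconnected [set: G])
    (cgG : compactly_generated G)
    (haar_mu : left_haar_measure mu) :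
  (geometrically_amenable mu <->
     exists (Gamma : simple_graph) (act : G -> Gamma -> Gamma),
       [/\ locally_finite Gamma, amenable_graph R Gamma,
           proper_action act & lipschitz_action (1 : R) act]) /\
  (folner_star mu = 0%E <->
     exists (Gamma : simple_graph) (act : G -> Gamma -> Gamma),
       [/\ locally_finite Gamma, amenable_graph R Gamma,
           proper_action act & contingently_lipschitz_action (1 : R) act]).
Proof.
split; split.
- exact: geometrically_amenable_lipschitz_action.
- exact: lipschitz_geometrically_amenable.
- exact: folner_star0_contingently_lipschitz_action.
- exact: contingently_lipschitz_folner_star0.
Qed.
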